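(* Let $\prec$ be the lexicographic term order on $K[\mathbf T_{\lambda-\mu}]$ with $T_{rc}>T_{r'c'}$ iff $r<r'$, or $r=r'$ and $c<c'$. (a) The initial ideal $\mathrm{in}_\prec(I_2(\mathbf T_{\lambda-\mu}))$ is squarefree, has height $\sum_{i=2}^n(\lambda_i-\mu_i-1)$, and its associated simplicial complex (the complex whose Stanley–Reisner ideal it is) is vertex decomposable; in particular it is Cohen–Macaulay. (b) The initial ideal $\mathrm{in}_\prec(I_2(\mathbf S_{\lambda-\mu}))$ is squarefree, has height $\max\{0,n-1-\mu_1\}+\sum_{i=2}^n(\lambda_i-\mu_i-1)$, and its associated simplicial complex is vertex decomposable; in particular it is Cohen–Macaulay. Moreover, if either of these initial ideals is nonzero, it can be obtained from an ideal generated by variables by a finite sequence of basic double links.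
   Context: Let $K$ be a field. Fix an integer $n\ge1$, a partition $\lambda=(\lambda_1,\dots,\lambda_n)$ of positive integers with $m:=\lambda_1\ge\lambda_2\ge\cdots\ge\lambda_n$, and an integer vector $\mu=(\mu_1,\dots,\mu_n)$ with $0\le\mu_1\le\cdots\le\mu_n<\lambda_n$ and $\mu_i\ge i-1$ for all $i$. The tableau $\mathbf T_{\lambda-\mu}$ is the set of positions $\{(i,j):1\le i\le n,\ \mu_i<j\le\lambda_i\}$ in an $m\times m$ array, and $K[\mathbf T_{\lambda-\mu}]$ is the polynomial ring over $K$ in the variables $T_{ij}$, $(i,j)\in\mathbf T_{\lambda-\mu}$; the entry of $\mathbf T_{\lambda-\mu}$ at $(i,j)$ is $T_{ij}$. The symmetrized tableau $\mathbf S_{\lambda-\mu}$ is the partially filled $m\times m$ array with set of positions $\{(i,j):(i,j)\in\mathbf T_{\lambda-\mu}\text{ or }(j,i)\in\mathbf T_{\lambda-\mu}\}$, whose entry at $(i,j)$ is $T_{ij}$ if $(i,j)\in\mathbf T_{\lambda-\mu}$ and $T_{ji}$ otherwise. For such an array $A$ with set of positions $P$ and entries $a_{ij}$, a 2-minor of $A$ is a polynomial $a_{ij}a_{kl}-a_{il}a_{kj}$ with $i<k$, $j<l$ and $(i,j),(i,l),(k,j),(k,l)\in P$. $I_2(\mathbf T_{\lambda-\mu})$ and $I_2(\mathbf S_{\lambda-\mu})$ denote the ideals of $K[\mathbf T_{\lambda-\mu}]$ generated by the 2-minors of $\mathbf T_{\lambda-\mu}$ and of $\mathbf S_{\lambda-\mu}$.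 A simplicial complex $\Delta$ is vertex decomposable if it is a simplex, or empty, or there is a vertex $k$ such that the link $\mathrm{lk}_\Delta(k)$ and the deletion $\Delta_{-k}$ are both pure and vertex decomposable and $\dim\Delta=\dim\Delta_{-k}=\dim\mathrm{lk}_\Delta(k)+1$. An ideal $I'$ of a polynomial ring $R$ is a basic double link of an ideal $I$ if $I'=fI+J$ for homogeneous ideals $J\subset I$ and a homogeneous polynomial $f$ with $\operatorname{ht}J=\operatorname{ht}I-1$, $J:f=J$, and $R/I$ and $R/J$ Cohen–Macaulay. *)

(* Defs.v *)
From HB Require Import structures.
From mathcomp Require Import all_boot all_order all_algebra.
From mathcomp Require Import mpoly.
From Stdlib Require Import ClassicalEpsilon.
Set Implicit Arguments. Unset Strict Implicit. Unset Printing Implicit Defensive.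
Import GRing.Theory.
Local Open Scope ring_scope.

Section Ideals.
Variable R : comNzRingType.
Implicit Types (I J P M : R -> Prop).

Definition subI I J := forall x, I x -> J x.
Definition eqI I J := forall x, I x <-> J x.
Definition ssubI I J := subI I J /\ exists x, J x /\ ~ I x.

Definition is_ideal I :=
  I 0 /\ (forall x y, I x -> I y -> I (x + y)) /\ (forall a x, I x -> I (a * x)).

Definition ideal_gen (S : R -> Prop) : R -> Prop := fun p =>
  exists l : seq (R * R), (forall x, x \in l -> S x.2) /\
                          p = \sum_(x <- l) x.1 * x.2.

Definition plusI I J : R -> Prop := ideal_gen (fun x => I x \/ J x).
Definition gens (s : seq R) : R -> Prop := ideal_gen (fun x => x \in s).
Definition mulI (f : R) I : R -> Prop := ideal_gen (fun x => exists g, I g /\ x = f * g).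
Definition colonI J (f : R) : R -> Prop := fun g => J (g * f).

Definition prime_ideal P :=
  is_ideal P /\ ~ P 1 /\ forall a b, P (a * b) -> P a \/ P b.
Definition maximal_ideal M :=
  is_ideal M /\ ~ M 1 /\ forall J, is_ideal J -> subI M J -> eqI J M \/ J 1.

Definition prime_chain_over I P (c : nat -> R -> Prop) (k : nat) :=
  (forall t, (t <= k)%N -> prime_ideal (c t) /\ subI I (c t)) /\
  (forall t, (t < k)%N -> ssubI (c t) (c t.+1)) /\ eqI (c k) P.

(* height of the prime P / I in R / I (= Krull dimension of (R/I)_P) *)
Definition rel_height I P (h : nat) :=
  (exists c, prime_chain_over I P c h) /\
  (forall c k, prime_chain_over I P c k -> (k <= h)%N).

Definition prime_height P h := rel_height (fun _ => False) P h.

Definition ideal_height I (h : nat) :=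
  (exists P, prime_ideal P /\ subI I P /\ prime_height P h) /\
  (forall P h', prime_ideal P -> subI I P -> prime_height P h' -> (h <= h')%N).

Definition reg_seq M I (fs : seq R) :=
  (forall f, f \in fs -> M f) /\
  (forall i, (i < size fs)%N -> forall g,
       plusI I (gens (take i fs)) (g * nth 0 fs i) -> plusI I (gens (take i fs)) g) /\
  ~ plusI I (gens fs) 1.

Definition grade M I (d : nat) :=
  (exists fs, reg_seq M I fs /\ size fs = d) /\
  (forall fs, reg_seq M I fs -> (size fs <= d)%N).

(* R/I is Cohen-Macaulay: for every maximal ideal M of R containing I,
   depth (R/I)_M = grade(M, R/I) equals dim (R/I)_M = height(M/I). *)
Definition CM_quot I :=
  forall M, maximal_ideal M -> subI I M ->
    exists d, grade M I d /\ rel_height I M d.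

End Ideals.

Section Complexes.
Variable V : finType.
Implicit Types D : {set {set V}}.

Definition link D (k : V) : {set {set V}} :=
  [set F in D | (k \notin F) && (k |: F \in D)].
Definition deletion D (k : V) : {set {set V}} := [set F in D | k \notin F].
Definition facet D (F : {set V}) :=
  (F \in D) && [forall G in D, (F \subset G) ==> (G == F)].
Definition pure D := forall F G, facet D F -> facet D G -> #|F| = #|G|.
(* dim D = maxcard D - 1 *)
Definition maxcard D : nat := \max_(F in D) #|F|.

Inductive vertex_decomposable : {set {set V}} -> Prop :=
| vd_simplex D (F : {set V}) : D = powerset F -> vertex_decomposable D
| vd_empty D : D = set0 -> vertex_decomposable D
| vd_step D (k : V) :
    [set k] \in D ->
    pure (link D k) -> pure (deletion D k) ->
    vertex_decomposable (link D k) -> vertex_decomposable (deletion D k) ->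
    maxcard D = maxcard (deletion D k) ->
    maxcard D = (maxcard (link D k)).+1 ->
    vertex_decomposable D.
End Complexes.

Definition pbool (P : Prop) : bool :=
  if excluded_middle_informative P then true else false.

Section Poly.
Variables (K : fieldType) (N : nat).
Local Notation R := {mpoly K[N]}.

Definition homog_poly (p : R) :=
  exists d, forall mm, mm \in msupp p -> mdeg mm = d.
Definition homog_ideal (I : R -> Prop) :=
  exists S : R -> Prop, (forall p, S p -> homog_poly p) /\ eqI I (ideal_gen S).

Definition sqfree_monomial_ideal (I : R -> Prop) :=
  exists S : 'X_{1..N} -> Prop, (forall mm, S mm -> forall i, (mm i <= 1)%N) /\
    eqI I (ideal_gen (fun p => exists mm, S mm /\ p = 'X_[mm])).

Definition var_ideal (I : R -> Prop) :=
  exists S : pred 'I_N, eqI I (ideal_gen (fun p => exists i, S i /\ p = 'X_i)).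

Definition SR_complex (I : R -> Prop) : {set {set 'I_N}} :=
  [set F : {set 'I_N} | pbool (~ I (\prod_(i in F) 'X_i))].

Definition basic_double_link (I I' : R -> Prop) :=
  exists (J : R -> Prop) (f : R),
    homog_ideal J /\ homog_ideal I /\ homog_poly f /\ subI J I /\
    (exists h, ideal_height I h.+1 /\ ideal_height J h) /\
    eqI (colonI J f) J /\ CM_quot I /\ CM_quot J /\
    eqI I' (plusI (mulI f I) J).

Definition obtained_by_bdl_from_var_ideal (I : R -> Prop) :=
  exists (c : nat -> R -> Prop) (k : nat),
    var_ideal (c 0%N) /\ (forall t, (t < k)%N -> basic_double_link (c t) (c t.+1)) /\
    eqI (c k) I.

(* term orders given by a strict "bigger variable" relation vgt:
   lexicographic comparison of exponent vectors *)
Definition lex_gt (vgt : 'I_N -> 'I_N -> bool) (m1 m2 : 'X_{1..N}) :=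
  exists v, (m2 v < m1 v)%N /\ forall w, vgt w v -> m1 w = m2 w.
Definition is_lead vgt (f : R) (mm : 'X_{1..N}) :=
  mm \in msupp f /\ forall m', m' \in msupp f -> m' != mm -> lex_gt vgt mm m'.
Definition init_ideal vgt (I : R -> Prop) : R -> Prop :=
  ideal_gen (fun p => exists f mm, I f /\ f != 0 /\ is_lead vgt f mm /\ p = 'X_[mm]).

(* 2-minors of a partially filled array (None = no position) *)
Definition minor2 (a : nat -> nat -> option R) (p : R) :=
  exists i j k l x y z w, (i < k)%N /\ (j < l)%N /\
    a i j = Some x /\ a k l = Some y /\ a i l = Some z /\ a k j = Some w /\
    p = x * y - z * w.
End Poly.

Unset Implicit Arguments.
Definition posT (n : nat) (lam mu : nat -> nat) (x : nat * nat) : bool :=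
  (1 <= x.1 <= n)%N && (mu x.1 < x.2 <= lam x.1)%N.

(* positions of T_{lambda-mu} in the m x m array, m = lam 1 *)
Definition TPos n lam mu :=
  {x : 'I_(lam 1%N).+1 * 'I_(lam 1%N).+1 | posT n lam mu (val x.1, val x.2)}.

Definition NV n lam mu : nat := #|{: TPos n lam mu}|.

Definition Tvar (K : fieldType) n lam mu (x : nat * nat) : {mpoly K[NV n lam mu]} :=
  match (insub (inord x.1, inord x.2) : option (TPos n lam mu)) with
  | Some p => 'X_(enum_rank p)
  | None => 0
  end.

Definition var_pos n lam mu (v : 'I_(NV n lam mu)) : nat * nat :=
  let p := enum_val v in (val (val p).1, val (val p).2).

Definition var_gt n lam mu (v w : 'I_(NV n lam mu)) : bool :=
  let: (r, c) := var_pos n lam mu v in let: (r', c') := var_pos n lam mu w in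
  (r < r')%N || ((r == r') && (c < c')%N).

Definition arrT (K : fieldType) n lam mu (i j : nat) : option {mpoly K[NV n lam mu]} :=
  if posT n lam mu (i, j) then Some (Tvar K n lam mu (i, j)) else None.

Definition arrS (K : fieldType) n lam mu (i j : nat) : option {mpoly K[NV n lam mu]} :=
  if posT n lam mu (i, j) then Some (Tvar K n lam mu (i, j))
  else if posT n lam mu (j, i) then Some (Tvar K n lam mu (j, i)) else None.

Definition I2T (K : fieldType) n lam mu : {mpoly K[NV n lam mu]} -> Prop := @ideal_gen _ (minor2 (arrT K n lam mu)).
Definition I2S (K : fieldType) n lam mu : {mpoly K[NV n lam mu]} -> Prop := @ideal_gen _ (minor2 (arrS K n lam mu)).

Definition inT (K : fieldType) n lam mu :=
  init_ideal (var_gt n lam mu) (I2T K n lam mu).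
Definition inS (K : fieldType) n lam mu :=
  init_ideal (var_gt n lam mu) (I2S K n lam mu).

(* Main.v *)
(** The 2-minors lie in the kernel of the toric map T_ij -> u_i u_j (for T, with the
columns shifted by n, which makes T a special case of S). A weight argument shows that
if two distinct monomials have the same image, the larger one is divisible by the
leading term of a 2-minor; hence these leading terms generate the initial ideal, which
is the edge ideal of a graph on the cells. Removing the last cell of the last row
splits this graph into two graphs of the same kind (the deletion and the link), so its
independence complex is vertex decomposable and the edge ideal is a basic double link
of the edge ideal of the link.

For Cohen-Macaulayness at a maximal ideal M, Zariski's lemma gives y_i in M, a multiple
of x_i depending on x_i only. The elementary symmetric polynomials e_d, ..., e_1 in the
y_i are a regular sequence on every coordinate subspace of dimension d, hence, by the
exact sequence of link and deletion, on the whole quotient. A regular sequence in M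
produces a chain of primes below M, and such a chain has length at most d because d + 1
polynomials in d variables are algebraically dependent. *)

From HB Require Import structures.
Require Import Defs.
From mathcomp Require Import all_boot all_order all_algebra.
From mathcomp Require Import mpoly zify ring.
From mathcomp Require classical_sets boolp.
From Stdlib Require Import Classical ClassicalEpsilon.
Set Implicit Arguments. Unset Strict Implicit. Unset Printing Implicit Defensive.
Import GRing.Theory.
Local Open Scope ring_scope.

(** * Ideals, regular sequences and chains of primes *)

(** [CM_quot] speaks of all maximal ideals, also of those that do not contain the variables, so a
    homogeneous system of parameters does not suffice: the regular sequence has to depend on [M]. It
    must also be one sequence for the whole recursion, although link and deletion have different
    coordinate subspaces as components; symmetric polynomials treat all subspaces of one dimension
    alike. Grade and height are defined in the ring itself, so their comparison uses chains of
    primes only and never localizes. The Groebner basis is not obtained by reducing S-pairs. Weights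
    are linear functionals on the exponents of toric images, and a suitable one refutes any leading
    monomial that avoids all corner pairs. The last cell of the last row is the right vertex to
    remove because its neighbours fill whole columns of the rows above, so what remains is again an
    array with nested rows. *)

Section IdealBasics.
Variable R : comNzRingType.
Implicit Types (I J L M P Q S : R -> Prop) (f g h x y : R).

Lemma is_ideal0 I : is_ideal I -> I 0. Proof. by case. Qed.
Lemma is_idealD I x y : is_ideal I -> I x -> I y -> I (x + y).
Proof. by case=> _ [h _]; apply: h. Qed.
Lemma is_idealMl I a x : is_ideal I -> I x -> I (a * x).
Proof. by case=> _ [_ h]; apply: h. Qed.
Lemma is_idealMr I a x : is_ideal I -> I x -> I (x * a).
Proof. by move=> iI Ix; rewrite mulrC; apply: is_idealMl. Qed.
Lemma is_idealN I x : is_ideal I -> I x -> I (- x).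
Proof. by move=> iI Ix; rewrite -mulN1r; apply: is_idealMl. Qed.
Lemma is_idealB I x y : is_ideal I -> I x -> I y -> I (x - y).
Proof. by move=> iI Ix Iy; apply: is_idealD => //; apply: is_idealN. Qed.
Lemma is_ideal_sum (T : Type) (r : seq T) (Pr : pred T) (F : T -> R) I :
  is_ideal I -> (forall i, Pr i -> I (F i)) -> I (\sum_(i <- r | Pr i) F i).
Proof.
by move=> iI hF; elim/big_ind: _ => //; [apply: is_ideal0|move=> ? ?; apply: is_idealD].
Qed.

Lemma is_ideal_gen S : is_ideal (ideal_gen S).
Proof.
split; [|split].
- by exists [::]; split=> //; rewrite big_nil.
- move=> x y [lx [hx ->]] [ly [hy ->]]; exists (lx ++ ly); split.
    by move=> z; rewrite mem_cat => /orP[/hx|/hy].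
  by rewrite big_cat.
- move=> a x [lx [hx ->]]; exists [seq (a * z.1, z.2) | z <- lx]; split.
    by move=> z /mapP[w /hx hw ->].
  by rewrite big_map big_distrr; apply: eq_bigr => z _ /=; rewrite mulrA.
Qed.

Lemma ideal_gen_sub S I : is_ideal I -> (forall x, S x -> I x) -> subI (ideal_gen S) I.
Proof.
move=> iI hS x [l [hl ->]]; rewrite big_seq.
by apply: is_ideal_sum => // z /hl/hS; apply: is_idealMl.
Qed.

Lemma mem_ideal_gen S x : S x -> ideal_gen S x.
Proof.
move=> Sx; exists [:: (1, x)]; split; last by rewrite big_seq1 mul1r.
by move=> z; rewrite inE => /eqP ->.
Qed.

Lemma is_ideal_ext I J : eqI I J -> is_ideal I -> is_ideal J.
Proof.
move=> e [I0 [ID IM]]; split; first exact/e.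
split; first by move=> x y /e Ix /e Iy; apply/e; apply: ID.
by move=> a x /e Ix; apply/e; apply: IM.
Qed.

(** The ideal I + (f) with a single explicit coefficient: unlike [plusI], it gives a decomposition
    of its members at once. *)
Definition addgen I f : R -> Prop := fun x => exists a u, I a /\ x = a + u * f.

Lemma is_ideal_addgen I f : is_ideal I -> is_ideal (addgen I f).
Proof.
move=> iI; split; first by exists 0, 0; split; [exact: is_ideal0|rewrite mul0r addr0].
split.
  move=> _ _ [a [u [Ia ->]]] [b [v [Ib ->]]]; exists (a + b), (u + v).
  by split; [exact: is_idealD|ring].
move=> c _ [a [u [Ia ->]]]; exists (c * a), (c * u).
by split; [exact: is_idealMl|ring].
Qed.

Lemma addgen_l I f x : I x -> addgen I f x.
Proof. by move=> Ix; exists x, 0; rewrite mul0r addr0. Qed.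

Lemma addgen_gen I f : is_ideal I -> addgen I f f.
Proof. by move=> iI; exists 0, 1; rewrite add0r mul1r; split=> //; exact: is_ideal0. Qed.

Lemma addgen_sub I J f : is_ideal J -> subI I J -> J f -> subI (addgen I f) J.
Proof.
by move=> iJ IJ Jf _ [a [u [/IJ Ja ->]]]; apply: is_idealD => //; apply: is_idealMl.
Qed.

Lemma addgen_mono I J f : subI I J -> subI (addgen I f) (addgen J f).
Proof. by move=> IJ _ [a [u [/IJ Ja ->]]]; exists a, u. Qed.

Lemma addgen_ext I J f : eqI I J -> eqI (addgen I f) (addgen J f).
Proof. by move=> e x; split; apply: addgen_mono => y /e. Qed.

Lemma addgenC I f g : eqI (addgen (addgen I f) g) (addgen (addgen I g) f).
Proof.
move=> x; split=> -[_ [u [[a [v [Ia ->]]] ->]]].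
  exists (a + u * g), v; split; last by ring.
  by exists a, u.
exists (a + u * f), v; split; last by ring.
by exists a, u.
Qed.

Lemma plusI_gens0 I : is_ideal I -> eqI (plusI I (gens [::])) I.
Proof.
move=> iI x; split; last by move=> Ix; apply: mem_ideal_gen; left.
by apply: ideal_gen_sub => // y [//|]; apply: ideal_gen_sub.
Qed.

Lemma plusI_gens_cons I f fs : is_ideal I ->
  eqI (plusI I (gens (f :: fs))) (plusI (addgen I f) (gens fs)).
Proof.
move=> iI x; split; apply: ideal_gen_sub; try exact: is_ideal_gen.
  move=> y [Iy|]; first by apply: mem_ideal_gen; left; apply: addgen_l.
  apply: ideal_gen_sub; first exact: is_ideal_gen.
  move=> z; rewrite inE => /orP[/eqP ->|zfs].
    by apply: mem_ideal_gen; left; exact: addgen_gen.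
  by apply: mem_ideal_gen; right; apply: mem_ideal_gen.
move=> y [[a [u [Ia ->]]]|].
  apply: is_idealD; first exact: is_ideal_gen.
    by apply: mem_ideal_gen; left.
  apply: is_idealMl; first exact: is_ideal_gen.
  by apply: mem_ideal_gen; right; apply: mem_ideal_gen; rewrite inE eqxx.
apply: ideal_gen_sub; first exact: is_ideal_gen.
move=> z zfs; apply: mem_ideal_gen; right; apply: mem_ideal_gen.
by rewrite inE zfs orbT.
Qed.

Definition nzd I f := forall g, I (g * f) -> I g.

(** Regularity without properness: the inductions below pass through the unit ideal, where it holds
    trivially. Properness is restored only inside a maximal ideal. *)
Fixpoint wreg I fs : Prop :=
  if fs is f :: fs' then nzd I f /\ wreg (addgen I f) fs' else True.

Lemma wregP I fs : is_ideal I -> wreg I fs <->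
  (forall i, (i < size fs)%N -> forall g,
       plusI I (gens (take i fs)) (g * nth 0 fs i) -> plusI I (gens (take i fs)) g).
Proof.
elim: fs I => [|f fs IH] I iI; first by split.
have iIf := is_ideal_addgen f iI.
rewrite /= (IH _ iIf); split.
  move=> [h1 h2] [|i] /= ilt g.
    by move=> /(plusI_gens0 iI) /h1 /(plusI_gens0 iI).
  by move=> /(plusI_gens_cons _ _ iI) /h2 h; apply/(plusI_gens_cons _ _ iI)/h.
move=> h; split.
  move=> g Igf; apply/(plusI_gens0 iI).
  by apply: (h 0%N) => //=; apply/(plusI_gens0 iI).
move=> i ilt g /(plusI_gens_cons _ _ iI) h'; apply/(plusI_gens_cons _ _ iI).
exact: (h i.+1).
Qed.

Lemma wreg_ext I J fs : eqI I J -> wreg I fs -> wreg J fs.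
Proof.
elim: fs I J => //= f fs IH I J e [h1 h2]; split.
  by move=> g /e/h1/e.
by apply: IH h2; apply: addgen_ext.
Qed.

Lemma wreg1 I fs : I 1 -> is_ideal I -> wreg I fs.
Proof.
elim: fs I => //= f fs IH I I1 iI; split.
  by move=> g _; rewrite -[g]mulr1; apply: is_idealMl.
by apply: IH; [exact: addgen_l|exact: is_ideal_addgen].
Qed.

(* The snake lemma for 0 -> R/L -f-> R/I -> R/(I + f) -> 0. *)
Lemma wreg_colon I L f fs : is_ideal I -> is_ideal L ->
    (forall h, I (h * f) <-> L h) ->
  wreg L fs -> wreg (addgen I f) fs -> wreg I fs.
Proof.
elim: fs I L => //= a fs IH I L iI iL col [nL wL] [nI wI]; split.
  move=> h Iha.
  have [i [u [Ii eh]]] : addgen I f h by apply: nI; apply: addgen_l.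
  rewrite eh; apply: is_idealD => //; apply/col/nL/col.
  have -> : u * a * f = h * a - i * a by rewrite eh; ring.
  by apply: is_idealB => //; apply: is_idealMr.
(* The colon of I + (a) by [f] is L + (a): if h f = i + u a, then [u] lies in I + (f), because [a]
   is a nonzerodivisor modulo that ideal. *)
apply: (IH _ (addgen L a)); try exact: is_ideal_addgen.
- move=> h; split.
    move=> [i [u [Ii e]]].
    have [j [w [Ij eu]]] : addgen I f u.
      apply: nI; exists (- i), h; split; first exact: is_idealN.
      by rewrite e; ring.
    exists (h - a * w), w; split; last by ring.
    apply/col.
    have -> : (h - a * w) * f = i + j * a by rewrite mulrBl e eu; ring.
    by apply: is_idealD => //; apply: is_idealMr.
  move=> [l [w [Ll ->]]]; exists (l * f), (w * f); split; first exact/col.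
  by ring.
- exact: wL.
- by apply: wreg_ext wI; apply: addgenC.
Qed.

Lemma prime_is_ideal P : prime_ideal P -> is_ideal P. Proof. by case. Qed.
Lemma prime_not1 P : prime_ideal P -> ~ P 1. Proof. by case=> _ []. Qed.
Lemma primeM P a b : prime_ideal P -> P (a * b) -> P a \/ P b.
Proof. by case=> _ [_]; apply. Qed.
Lemma primeX P a k : prime_ideal P -> P (a ^+ k) -> P a.
Proof.
move=> pP; elim: k => [|k IH]; first by rewrite expr0 => /(prime_not1 pP).
by rewrite exprS => /(primeM pP)[|/IH].
Qed.

Lemma maximal_prime M : maximal_ideal M -> prime_ideal M.
Proof.
move=> [iM [M1 maxM]]; split=> //; split=> // a b Mab.
case: (classic (M a)) => [|Ma]; [by left|right].
have [e|[m [u [Mm e1]]]] : eqI (addgen M a) M \/ addgen M a 1.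
- by apply: maxM; [exact: is_ideal_addgen|move=> x; apply: addgen_l].
- by case: Ma; apply/e; exact: addgen_gen.
rewrite -[b]mul1r e1 mulrDl; apply: is_idealD => //; first exact: is_idealMr.
by rewrite -mulrA; apply: is_idealMl.
Qed.

Lemma maximal_inv M a : maximal_ideal M -> ~ M a -> exists b, M (1 - b * a).
Proof.
move=> [iM [M1 maxM]] Ma.
have [e|[m [u [Mm e1]]]] : eqI (addgen M a) M \/ addgen M a 1.
- by apply: maxM; [exact: is_ideal_addgen|move=> x; apply: addgen_l].
- by case: Ma; apply/e; exact: addgen_gen.
by exists u; rewrite e1 addrK.
Qed.

(* An ideal maximal among those containing [J] and avoiding the multiplicative
   set {f^k s : s not in Q} is prime; since [f] is a nonzerodivisor modulo [J],
   this set does not meet [J]. *)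
Lemma prime_below Q J f : prime_ideal Q -> is_ideal J -> subI J Q -> Q f -> nzd J f ->
  exists P, [/\ prime_ideal P, subI J P, subI P Q & ~ P f].
Proof.
move=> pQ iJ JQ Qf nf.
pose msys x := exists k s, ~ Q s /\ x = f ^+ k * s.
have msysM x y : msys x -> msys y -> msys (x * y).
  move=> [k [s [Qs ->]]] [k' [s' [Qs' ->]]]; exists (k + k')%N, (s * s').
  by split; [case/(primeM pQ)|rewrite exprD; ring].
have msys1 : msys 1 by exists 0%N, 1; split; [exact: prime_not1|rewrite expr0 mulr1].
have msysJ x : msys x -> ~ J x.
  move=> [k [s [Qs ->]]]; rewrite mulrC; elim: k => [|k IH].
    by rewrite expr0 mulr1 => /JQ.
  by rewrite exprSr mulrA => /nf.
pose good (A : R -> Prop) := (forall x, A x -> is_ideal A /\ forall y, msys y -> ~ A y).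
(* Zorn's lemma also asks for the union of the empty chain; joining [J] to every set turns that
   union into the ideal [J]. *)
have [A [gA maxA]] : exists A : classical_sets.set R,
    good (fun x => A x \/ J x) /\
    forall B, classical_sets.proper A B -> ~ good (fun x => B x \/ J x).
  apply: (@classical_sets.Zorn_bigcup _ (fun A => good (fun x => A x \/ J x))).
  move=> F FP tot x _.
  case: (classic (exists X0, F X0)) => [[X0 FX0]|noF]; last first.
    have e : forall y, (classical_sets.bigcup F id y \/ J y) <-> J y.
      by move=> y; split=> [[[X FX _]|//]|]; [case: noF; exists X|right].
    split; first by apply: is_ideal_ext iJ => y; rewrite e.
    by move=> y my; rewrite e; apply: msysJ.
  have idX X : F X -> is_ideal (fun y => X y \/ J y) /\ forall y, msys y -> ~ (X y \/ J y).
    by move=> FX; apply: (FP X FX 0); right; apply: is_ideal0.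
  have mem X y : F X -> X y -> classical_sets.bigcup F id y by move=> FX Xy; exists X.
  have in_one y : classical_sets.bigcup F id y \/ J y -> exists2 X, F X & X y \/ J y.
    by move=> [[X FX Xy]|Jy]; [exists X => //; left|exists X0 => //; right].
  have back X y : F X -> X y \/ J y -> classical_sets.bigcup F id y \/ J y.
    by move=> FX [Xy|]; [left; apply: mem FX Xy|right].
  split; last first.
    by move=> y my /in_one[X FX Xy]; case: (idX X FX) => _ /(_ y my).
  split; first by right; apply: is_ideal0.
  split.
    move=> y z /in_one[X FX Xy] /in_one[Y FY Yz].
    have [XY|YX] := tot X Y FX FY.
      apply: (back Y) => //; apply: (@is_idealD (fun w => Y w \/ J w)) => //; first by case: (idX Y FY).
      by case: Xy => [/XY|]; [left|right].
    apply: (back X) => //; apply: (@is_idealD (fun w => X w \/ J w)) => //; first by case: (idX X FX).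
    by case: Yz => [/YX|]; [left|right].
  move=> a y /in_one[X FX Xy]; apply: (back X) => //.
  by apply: (@is_idealMl (fun w => X w \/ J w)) => //; case: (idX X FX).
pose P x := A x \/ J x.
have [iP mP] : is_ideal P /\ forall y, msys y -> ~ P y.
  by apply: (gA 0); right; apply: is_ideal0.
have big g : ~ P g -> exists2 y, msys y & addgen P g y.
  move=> Pg; apply: NNPP => no.
  have iB := is_ideal_addgen g iP.
  apply: (maxA (addgen P g)).
    split; first by move=> x Ax; apply: addgen_l; left.
    move=> h; apply: Pg; left; apply: h; exact: addgen_gen.
  have e y : (addgen P g y \/ J y) <-> addgen P g y.
    by split=> [[//|Jy]|]; [apply: addgen_l; right|left].
  move=> x _; split; first by apply: is_ideal_ext iB => y; rewrite e.
  by move=> y my; rewrite e => By; apply: no; exists y.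
exists P; split.
- split=> //; split; first exact: mP.
  move=> a b Pab; case: (classic (P a)) => [|na]; [by left|right].
  apply: NNPP => nb.
  have [y my [p [u [Pp ey]]]] := big _ na.
  have [z mz [q [v [Pq ez]]]] := big _ nb.
  apply: (mP (y * z)); first exact: msysM.
  have -> : y * z = (q + v * b) * p + u * a * q + (u * v) * (a * b).
    by rewrite ey ez; ring.
  by do 2?[apply: (is_idealD iP)]; apply: (is_idealMl _ iP).
- by move=> x; right.
- move=> x Px; apply: NNPP => nQ; apply: (mP x) => //.
  by exists 0%N, x; rewrite expr0 mul1r.
- move=> Pf; apply: (mP f) => //; exists 1%N, 1; split; first exact: prime_not1.
  by rewrite expr1 mulr1.
Qed.

Definition has_chain I P k := exists c, prime_chain_over I P c k.

Lemma has_chain0 I P : prime_ideal P -> subI I P -> has_chain I P 0.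
Proof. by move=> pP IP; exists (fun _ => P); split; [|split]. Qed.

Lemma prime_ext P Q : eqI P Q -> prime_ideal P -> prime_ideal Q.
Proof.
move=> e [iP [P1 PM]]; split; first exact: is_ideal_ext iP.
by split=> [/e//|a b /e/PM[]]; [left|right]; apply/e.
Qed.

Lemma has_chain_prime I P k : has_chain I P k -> prime_ideal P /\ subI I P.
Proof.
move=> [c [h [_ e]]]; have [pc Ic] := h k (leqnn k).
by split; [apply: prime_ext pc|move=> x /Ic/e].
Qed.

Lemma has_chain_rcons I P Q k : has_chain I P k -> prime_ideal Q -> ssubI P Q ->
  has_chain I Q k.+1.
Proof.
move=> hc pQ [PQ [x [Qx Px]]]; have [pP IP] := has_chain_prime hc.
case: hc => c [h [hs e]].
exists (fun t => if (t <= k)%N then c t else Q); split; [|split].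
- move=> t tk; case: ifP => [/h//|_]; split=> // y /IP; apply: PQ.
- move=> t; rewrite ltnS => tk; rewrite tk; case: ifP => tk'; first exact: hs.
  have -> : t = k by lia.
  split; first by move=> y /e; apply: PQ.
  by exists x; split=> // /e.
- by rewrite ltnn.
Qed.

Lemma has_chain_last I P Q k : has_chain I P k -> prime_ideal Q -> subI P Q ->
  has_chain I Q k.
Proof.
move=> hc pQ PQ; have [pP IP] := has_chain_prime hc; case: hc => c [h [hs e]].
exists (fun t => if t == k then Q else c t); split; [|split].
- by move=> t tk; case: ifP => _; [split=> // x /IP/PQ|apply: h].
- move=> t tk; rewrite (ltn_eqF tk); case: ifP => [/eqP tk'|_]; last exact: hs.
  have [sub [x [cx ncx]]] := hs _ tk; rewrite tk' in sub cx.
  split; first by move=> y /sub/e/PQ.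
  by exists x; split=> //; apply/PQ/e.
- by rewrite eqxx.
Qed.

(** Each regular element buys one prime: the chain over I + (f) starts at a prime containing [f],
    and [prime_below] puts under it a prime over [I] that misses [f]. *)
Lemma wreg_chain I Q fs : is_ideal I -> prime_ideal Q -> subI I Q ->
  (forall f, f \in fs -> Q f) -> wreg I fs -> has_chain I Q (size fs).
Proof.
elim: fs I => [|f fs IH] I iI pQ IQ Qfs /=; first by move=> _; apply: has_chain0.
move=> [nf wf]; have Qf : Q f by apply: Qfs; rewrite inE eqxx.
have iQ := prime_is_ideal pQ.
have [c [h [hs e]]] : has_chain (addgen I f) Q (size fs).
  apply: IH => //; [exact: is_ideal_addgen|exact: addgen_sub|].
  by move=> g gfs; apply: Qfs; rewrite inE gfs orbT.
have [pc0 Ic0] := h 0%N (leq0n _).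
have c0f : c 0%N f by apply: Ic0; exact: addgen_gen.
have [P [pP IP Pc0 Pf]] : exists P, [/\ prime_ideal P, subI I P, subI P (c 0%N) & ~ P f].
  by apply: prime_below => // x Ix; apply: Ic0; apply: addgen_l.
exists (fun t => if t is t'.+1 then c t' else P); split; [|split=> //].
- case=> [|t] //; rewrite ltnS => /h[pct Ict]; split=> // x Ix.
  by apply: Ict; apply: addgen_l.
- case=> [_|t]; last by rewrite ltnS; apply: hs.
  by split=> //; exists f.
Qed.

End IdealBasics.

(** * Krull dimension of polynomial rings *)

Section Monomials.
Variables (D : nat) (R : comNzRingType).

(** Exponent vectors as nested pairs, so that an induction along a chain of primes peels off one
    element at a time. *)
Fixpoint idx (r : nat) : finType :=
  if r is r'.+1 then ('I_D * idx r')%type else unit.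

Fixpoint mon (r : nat) (z : nat -> R) : idx r -> R :=
  if r is r'.+1 then fun e => z 0%N ^+ e.1 * mon (fun t => z t.+1) e.2
  else fun _ => 1.

Lemma card_idx r : #|idx r| = (D ^ r)%N.
Proof. by elim: r => [|r IH] /=; rewrite ?card_unit // card_prod card_ord IH expnS. Qed.

(** The power [z ^+ a] factors out and is not in the prime [P0]; the cofactor, which is [s a] plus a
    multiple of [z], therefore lies in [P0], hence in [P1], which contains [z]. *)
Lemma lowest_coef (P0 P1 : R -> Prop) (z : R) (s : nat -> R) (a : nat) :
  prime_ideal P0 -> prime_ideal P1 -> subI P0 P1 -> P1 z -> ~ P0 z ->
  P0 (\sum_(b < D) z ^+ b * s b) -> (a < D)%N -> (forall b, (b < a)%N -> s b = 0) ->
  P1 (s a).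
Proof.
move=> p0 p1 P01 P1z P0z + aD s0.
rewrite -(big_mkord xpredT (fun b => z ^+ b * s b)) (big_cat_nat (n := a)) ?(ltnW aD) //=.
rewrite big_nat_cond big1 ?add0r; last first.
  by move=> b /andP[/andP[_ ba] _]; rewrite s0 // mulr0.
rewrite big_ltn // big_nat_cond.
have -> : \sum_(a.+1 <= i < D | (a < i < D)%N && true) z ^+ i * s i =
    z ^+ a * (z * \sum_(a.+1 <= i < D | (a < i < D)%N && true) z ^+ (i - a.+1) * s i).
  rewrite !big_distrr; apply: eq_bigr => i /andP[/andP[ai _] _] /=.
  by rewrite mulrA -exprSr mulrA -exprD subnKC.
rewrite -mulrDr => /(primeM p0)[/(primeX p0)//|/P01 h].
have i1 := prime_is_ideal p1.
rewrite -[s a](addrK (z * \sum_(a.+1 <= i < D | (a < i < D)%N && true)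
  z ^+ (i - a.+1) * s i)).
by apply: is_idealB => //; apply: is_idealMr.
Qed.

End Monomials.

Section Dimension.
Variables (K : fieldType) (N : nat).
Local Notation R := {mpoly K[N]}.

Lemma mpoly_gen_ind (P : R -> Prop) :
  (forall c, P c%:MP) -> (forall i, P 'X_i) ->
  (forall p q, P p -> P q -> P (p + q)) -> (forall p q, P p -> P q -> P (p * q)) ->
  forall p, P p.
Proof.
move=> PC PX PD PM p; rewrite [p]mpolyE.
elim/big_ind: _ => [||m _]; [exact: (PC 0)|exact: PD|].
rewrite -mul_mpolyC; apply: (PM) => //; rewrite mpolyXE_id.
elim/big_ind: _ => [||i _]; [exact: (PC 1)|move=> ? ?; apply: (PM)|].
by elim: (m i) => [|k IH]; rewrite ?expr0 ?exprS; [exact: (PC 1)|exact: PM].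
Qed.

(** Sort a relation by powers of [z 0]: its lowest nonzero coefficient lies in [P 1], and the chain
    from there on forces all scalars of this coefficient to vanish. *)
Lemma chain_indep D r (z : nat -> R) (P : nat -> R -> Prop) :
  (forall t, (t <= r)%N -> prime_ideal (P t)) ->
  (forall t, (t < r)%N -> subI (P t) (P t.+1)) ->
  (forall t, (t < r)%N -> P t.+1 (z t) /\ ~ P t (z t)) ->
  forall a : idx D r -> K,
  P 0%N (\sum_e (a e)%:MP * mon z e) -> forall e, a e = 0.
Proof.
elim: r z P => [|r IH] z P pP sP zP a.
  rewrite [X in P 0%N X](big_pred1 tt); last by case.
  rewrite /= mulr1 => h [].
  apply/eqP; apply: contraPT (prime_not1 (pP 0%N isT)) => a0; apply.
  have -> : 1 = (a tt)^-1%:MP * (a tt)%:MP :> R by rewrite -mpolyCM mulVf ?mpolyC1.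
  by apply: is_idealMl => //; apply/prime_is_ideal/pP.
pose s b := \sum_(e : idx D r)
  (if insub b is Some i then a (i, e) else 0)%:MP * mon (fun t => z t.+1) e.
have -> : \sum_(e : idx D r.+1) (a e)%:MP * mon z e = \sum_(b < D) z 0%N ^+ b * s b.
  rewrite [LHS](eq_bigr (fun e => (a (e.1, e.2))%:MP *
    (z 0%N ^+ e.1 * mon (fun t => z t.+1) e.2))); last by case.
  rewrite -(pair_bigA _ (fun i e => (a (i, e))%:MP *
    (z 0%N ^+ i * mon (fun t => z t.+1) e))) /=.
  apply: eq_bigr => b _; rewrite big_distrr; apply: eq_bigr => e _ /=.
  by rewrite valK mulrCA.
move=> h.
have s0 b (bD : (b < D)%N) : forall e, a (Ordinal bD, e) = 0.
  elim/ltn_ind: b bD => b IHb bD.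
  apply: (IH (fun t => z t.+1) (fun t => P t.+1)); try by move=> t tr; (apply: pP || apply: sP || apply: zP).
  have <- : s b = \sum_e (a (Ordinal bD, e))%:MP * mon (fun t => z t.+1) e.
    by rewrite /s insubT.
  apply: (@lowest_coef D _ (P 0%N) _ (z 0%N) s b _ _ _ _ _ h bD); [exact: pP|exact: pP|exact: sP| | |].
  - by case: (zP 0%N isT).
  - by case: (zP 0%N isT).
  move=> b' b'b; rewrite /s big1 // => e _.
  have b'D : (b' < D)%N by apply: ltn_trans bD.
  by rewrite insubT IHb // mpolyC0 mul0r.
by case=> [[b bD] e]; apply: s0.
Qed.

(** Degrees are bounded in each variable separately, so the admissible monomials form a box and are
    counted by a power; a bound 0 also records that a variable does not occur. *)
Definition bnd (b : 'I_N -> nat) (p : R) := forall m, m \in msupp p -> forall i, (m i <= b i)%N.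

Lemma bndW b b' p : (forall i, (b i <= b' i)%N) -> bnd b p -> bnd b' p.
Proof. by move=> bb h m mp i; apply: leq_trans (bb i); apply: h. Qed.

Lemma bndD b p q : bnd b p -> bnd b q -> bnd b (p + q).
Proof. by move=> hp hq m /msuppD_le; rewrite mem_cat => /orP[/hp|/hq]. Qed.

Lemma bndM b b' p q : bnd b p -> bnd b' q -> bnd (fun i => b i + b' i)%N (p * q).
Proof.
move=> hp hq m /msuppM_le /allpairsP[[m1 m2] /= [h1 h2 ->]] i.
by rewrite mnmDE leq_add // ?(hp _ h1) ?(hq _ h2).
Qed.

Lemma bndC b c : bnd b c%:MP.
Proof. by move=> m; rewrite msuppC; case: ifP => // _; rewrite inE => /eqP -> i; rewrite mnm0E. Qed.

Lemma bndX b p k : bnd b p -> bnd (fun i => k * b i)%N (p ^+ k).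
Proof.
move=> hp; elim: k => [|k IH]; first by rewrite expr0 -mpolyC1; apply: bndC.
by rewrite exprS; apply: bndW (bndM hp IH) => i; rewrite mulSn.
Qed.

Lemma bnd_mon D r b (z : nat -> R) (e : idx D r) :
  (forall t, (t < r)%N -> bnd b (z t)) -> bnd (fun i => r * (D * b i))%N (mon z e).
Proof.
elim: r z e => [|r IH] z e hz /=; first by rewrite -mpolyC1; apply: bndC.
have h1 := bndX (k := e.1) (hz 0%N isT).
have h2 : bnd (fun i => r * (D * b i))%N (mon (fun t => z t.+1) e.2).
  by apply: IH => t tr; apply: hz.
apply: bndW (bndM h1 h2) => i.
by rewrite mulSn leq_add2r leq_mul2r (ltnW (ltn_ord _)) orbT.
Qed.

(* There are more monomials of box size [D] in [#|F|.+1] elements than monomials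
   available to them, once [D] is large. *)
Lemma alg_dependent (F : {set 'I_N}) c (z : nat -> R) :
  (forall t, (t < #|F|.+1)%N -> bnd (fun i => c * (i \in F))%N (z t)) ->
  exists D (a : idx D #|F|.+1 -> K),
    \sum_e (a e)%:MP * mon z e = 0 /\ exists e, a e != 0.
Proof.
move=> hz; set r := #|F|.+1 in hz *.
(* The monomials available number at most ((r c + 1) D)^|F|, against D^(|F| + 1) products; so [D]
   has to exceed (r c + 1)^|F|. *)
pose D := ((r * c).+1 ^ #|F|).+1; exists D.
pose B := (r * (D * c))%N.
pose T := {ffun {i | i \in F} -> 'I_B.+1}.
pose mm (t : T) : 'X_{1..N} :=
  [multinom (if insub i is Some j then t j : nat else 0%N) | i < N].
pose A : 'M[K]_(#|idx D r|, #|{: T}|) :=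
  \matrix_(i, j) (mon z (enum_val i))@_(mm (enum_val j)).
have lt : (#|{: T}| < #|idx D r|)%N.
  rewrite card_idx card_ffun card_ord card_sig /r.
  rewrite expnS; apply: (@leq_ltn_trans (((r * c).+1 * D) ^ #|F|)).
    have hB : (B.+1 <= (r * c).+1 * D)%N by rewrite /B /D; nia.
    by elim: #|F| => // k IH; rewrite !expnS leq_mul.
  by rewrite expnMn ltn_pmul2r ?expn_gt0.
have /rowV0Pn[u /sub_kermxP uA u0] : kermx A != 0.
  rewrite -mxrank_eq0 mxrank_ker subn_eq0 -ltnNge.
  exact: leq_ltn_trans (rank_leq_col A) lt.
exists (fun e => u 0 (enum_rank e)); split; last first.
  have [/= i ui] : exists i, u 0 i != 0.
    apply/existsP; apply: contraNT u0; rewrite negb_exists => /forallP h.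
    by apply/eqP/rowP => i; rewrite mxE; apply/eqP; rewrite -[_ == _]negbK h.
  by exists (enum_val i); rewrite enum_valK.
apply/mpolyP => m; rewrite mcoeff0 raddf_sum /=.
case: (boolP [forall i, m i <= B * (i \in F)]%N) => [/forallP mB|]; last first.
  rewrite negb_forall => /existsP[i mi]; rewrite big1 // => e _.
  rewrite mcoeffCM memN_msupp_eq0 ?mulr0 //; apply: contra mi => me.
  apply: leq_trans (bnd_mon hz me i) _.
  by rewrite /B !mulnA.
pose t : T := [ffun j => inord (m (val j))].
have -> : m = mm t.
  apply/mnmP => i; rewrite mnmE; have := mB i.
  case: insubP => [j iF ij|/negbTE iF]; last by rewrite iF muln0 leqn0 => /eqP.
  by rewrite iF muln1 ffunE ij => mi; rewrite inordK.
have := congr1 (fun M : 'rV_#|{: T}| => M 0 (enum_rank t)) uA.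
rewrite !mxE => e; rewrite -[RHS]e (reindex (fun i : 'I_#|idx D r| => enum_val i)) /=; last first.
  by apply: onW_bij; apply: enum_val_bij.
by apply: eq_bigr => i _; rewrite mcoeffCM enum_valK !mxE enum_rankK.
Qed.

Definition kill (F : {set 'I_N}) : R -> R :=
  mmap (@mpolyC N K) (fun i => if i \in F then 'X_i else 0).

HB.instance Definition _ F := GRing.RMorphism.copy (kill F)
  (mmap (@mpolyC N K) (fun i => if i \in F then 'X_i else 0)).

Lemma killD F : {morph kill F : p q / p + q}. Proof. exact: rmorphD. Qed.
Lemma killM F : {morph kill F : p q / p * q}. Proof. exact: rmorphM. Qed.

Lemma killX F i : kill F 'X_i = if i \in F then 'X_i else 0.
Proof. by rewrite /kill mmapX mmap1U. Qed.

Lemma killC F c : kill F c%:MP = c%:MP.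
Proof. exact: mmapC. Qed.

Lemma kill_congr (I : R -> Prop) (F : {set 'I_N}) p : is_ideal I ->
  (forall i, i \notin F -> I 'X_i) -> I (p - kill F p).
Proof.
move=> iI hI; elim/mpoly_gen_ind: p => [c|i|p q Ip Iq|p q Ip Iq].
- by rewrite killC subrr; apply: is_ideal0.
- rewrite killX; case: ifP => iF; rewrite ?subrr ?subr0; first exact: is_ideal0.
  by apply: hI; rewrite iF.
- by rewrite killD opprD addrACA; apply: is_idealD.
- have -> : p * q - kill F (p * q) = p * (q - kill F q) + kill F q * (p - kill F p).
    by rewrite killM; ring.
  by apply: is_idealD => //; apply: is_idealMl.
Qed.

(** The prime of a coordinate subspace, generated by the variables outside [F]. As the kernel of a
    map into a domain it is visibly prime. *)
Definition vprime F : R -> Prop := fun p => kill F p = 0.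

Lemma vprime_prime F : prime_ideal (vprime F).
Proof.
split; [|split].
- split; first by rewrite /vprime rmorph0.
  split; first by move=> x y hx hy; rewrite /vprime killD hx hy addr0.
  by move=> a x hx; rewrite /vprime killM hx mulr0.
- by rewrite /vprime rmorph1; apply/eqP; apply: oner_neq0.
- move=> a b; rewrite /vprime killM => /eqP; rewrite mulf_eq0.
  by case/orP => /eqP; [left|right].
Qed.

Lemma vprimeX (F : {set 'I_N}) i : vprime F 'X_i <-> i \notin F.
Proof.
rewrite /vprime killX; case: ifP => // _; split=> // /eqP.
by rewrite -[_ == _]negbK -msupp_eq0 msuppX.
Qed.

Lemma vprime_sub (I : R -> Prop) (F : {set 'I_N}) : is_ideal I ->
  (forall i, i \notin F -> I 'X_i) -> subI (vprime F) I.
Proof. by move=> iI hI p hp; have := kill_congr p iI hI; rewrite hp subr0. Qed.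

Lemma vprime_mono (F G : {set 'I_N}) : G \subset F -> subI (vprime F) (vprime G).
Proof.
move=> GF; apply: vprime_sub; first exact/prime_is_ideal/vprime_prime.
by move=> i iF; apply/vprimeX; apply: contra iF; apply: (subsetP GF).
Qed.

Lemma bnd_kill (F : {set 'I_N}) p : exists c, bnd (fun i => c * (i \in F))%N (kill F p).
Proof.
elim/mpoly_gen_ind: p => [c|i|p q [c hp] [d hq]|p q [c hp] [d hq]].
- by exists 0%N; rewrite killC; apply: bndC.
- exists 1%N; rewrite killX; case: ifP => iF; last by rewrite -mpolyC0; apply: bndC.
  move=> m; rewrite msuppX inE => /eqP -> j; rewrite mnm1E.
  by case: eqP => // <-; rewrite iF.
- exists (c + d)%N; rewrite killD; apply: bndD.
    by apply: bndW hp => i; rewrite leq_mul2r leq_addr orbT.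
  by apply: bndW hq => i; rewrite leq_mul2r leq_addl orbT.
- by exists (c + d)%N; rewrite killM; apply: bndW (bndM hp hq) => i; rewrite mulnDl.
Qed.

(** Modulo every prime of the chain a polynomial equals its image under [kill F], so the witnesses
    of strict inclusion can be taken in the variables of [F]; more than |F| of them would be
    dependent, against [chain_indep]. *)
Lemma dim_bound (I P : R -> Prop) F k :
  subI (vprime F) I -> has_chain I P k -> (k <= #|F|)%N.
Proof.
move=> FI [c [h [hs _]]]; rewrite leqNgt; apply/negP => Fk.
have hz t : exists z, (t <= #|F|)%N -> c t.+1 z /\ ~ c t z.
  case: (leqP t #|F|) => [tF|]; last by exists 0.
  by have [_ [z hz]] := hs t (leq_ltn_trans tF Fk); exists z.
pose z t := kill F (proj1_sig (constructive_indefinite_description _ (hz t))).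
have zP t : (t < #|F|.+1)%N -> c t.+1 (z t) /\ ~ c t (z t).
  rewrite ltnS /z; case: constructive_indefinite_description => x /= hx tF.
  have [c1 c0] := hx tF.
  have [p1 I1] := h t.+1 (leq_ltn_trans tF Fk).
  have [p0 I0] := h t (ltnW (leq_ltn_trans tF Fk)).
  have Fx : forall J, prime_ideal J -> subI I J -> J (x - kill F x).
    move=> J pJ IJ; apply: kill_congr; first exact: prime_is_ideal.
    by move=> i iF; apply/IJ/FI/vprimeX.
  split.
    have -> : kill F x = x - (x - kill F x) by ring.
    by apply: is_idealB => //; [exact: prime_is_ideal|exact: Fx].
  move=> ck; apply: c0; have -> : x = (x - kill F x) + kill F x by ring.
  by apply: is_idealD => //; [exact: prime_is_ideal|exact: Fx].
have [b hb] : exists b, forall t, (t < #|F|.+1)%N -> bnd (fun i => b * (i \in F))%N (z t).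
  elim: (#|F|.+1) => [|r [b hb]]; first by exists 0%N.
  have [b' hb'] := bnd_kill F (proj1_sig (constructive_indefinite_description _ (hz r))).
  exists (b + b')%N => t; rewrite ltnS leq_eqVlt => /orP[/eqP ->|/hb].
    by apply: bndW hb' => i; rewrite leq_mul2r leq_addl orbT.
  by apply: bndW => i; rewrite leq_mul2r leq_addr orbT.
have [D [a [ea [e0 ae0]]]] := alg_dependent hb.
have a0 : a e0 = 0.
  apply: (@chain_indep D #|F|.+1 z c) => //.
  - by move=> t tF; case: (h t (leq_trans tF Fk)).
  - by move=> t tF; case: (hs t (leq_trans tF Fk)).
  by rewrite ea; apply: is_ideal0; apply: prime_is_ideal; case: (h 0%N isT).
by rewrite a0 eqxx in ae0.
Qed.

End Dimension.

(** * Zariski's lemma *)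

Section Zariski.
Variable E : fieldType.

(* The image of [f] is a Goldman domain: inverting a single element makes it a field. *)
Definition gdomain (A : comNzRingType) (f : {rmorphism A -> E}) :=
  exists s, f s != 0 /\ forall b, f b != 0 -> exists t c, f s ^+ t = f b * f c.

Section Adjoin.
Variables (A : comNzRingType) (f : {rmorphism A -> E}) (x : E).

Definition evalat (p : {poly A}) : E := (map_poly f p).[x].

Lemma evalat_is_nmod : GRing.nmod_morphism evalat.
Proof. by split=> [|p q]; rewrite /evalat ?rmorph0 ?rmorphD ?horner0 ?hornerD. Qed.
Lemma evalat_is_monoid : GRing.monoid_morphism evalat.
Proof. by split=> [|p q]; rewrite /evalat ?rmorph1 ?rmorphM ?hornerC ?hornerM. Qed.
HB.instance Definition _ := GRing.isNmodMorphism.Build {poly A} E evalat evalat_is_nmod.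
HB.instance Definition _ := GRing.isMonoidMorphism.Build {poly A} E evalat evalat_is_monoid.

Lemma evalatC a : evalat a%:P = f a.
Proof. by rewrite /evalat map_polyC hornerC. Qed.
Lemma evalatX : evalat 'X = x.
Proof. by rewrite /evalat map_polyX hornerX. Qed.

(* Otherwise [A[x]] is a polynomial ring, where [1 + X s] divides no power of [s]. *)
Lemma gdomain_algebraic : gdomain evalat ->
  exists p, map_poly f p != 0 /\ evalat p = 0.
Proof.
move=> [s [s0 hs]]; apply: NNPP => no.
have inj p : evalat p = 0 -> map_poly f p = 0.
  by move=> p0; apply/eqP; rewrite -[_ == _]negbK; apply/negP => p1; apply: no; exists p.
pose sm := map_poly f s.
have sm0 : sm != 0 by apply: contraNneq s0; rewrite /sm => e; apply/eqP; rewrite [LHS]/= /evalat e horner0.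
pose b := 1 + s * 'X.
have bmE : map_poly f b = 1 + sm * 'X by rewrite rmorphD rmorphM rmorph1 /= map_polyX.
have sb : size (1 + sm * 'X) = (size sm).+1.
  by rewrite addrC size_polyDl size_mulX // size_poly1 ltnS size_poly_gt0.
have eb : evalat b != 0.
  apply: contraNneq sm0 => /inj; rewrite bmE => e.
  by move: sb; rewrite e size_poly0.
have [t [c e]] := hs _ eb.
have : evalat (s ^+ t - b * c) = 0 by rewrite rmorphB rmorphXn rmorphM e subrr.
move=> /inj; rewrite rmorphB rmorphXn rmorphM /= bmE => /eqP; rewrite subr_eq0 => /eqP ec.
have : (1 + sm * 'X) %| (1 : {poly E}).
  have d1 : (1 + sm * 'X) %| (sm * 'X) ^+ t by rewrite exprMn ec -mulrA dvdp_mulIl.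
  have d2 : coprimep (1 + sm * 'X) ((sm * 'X) ^+ t).
    apply/coprimep_expr/Bezout_coprimepP; exists (1, -1).
    by rewrite /= mul1r mulN1r addrK eqpxx.
  by rewrite -(Gauss_dvdpr 1 d2) mulr1.
by rewrite dvdp1 sb eqSS size_poly_eq0 (negbTE sm0).
Qed.

(** With a the leading coefficient, multiplying the equation of [x] by the power of a one below the
    degree makes it monic in a x. *)
Lemma integral_scaled (p : {poly A}) :
  f (lead_coef p) != 0 -> evalat p = 0 -> integralOver f (f (lead_coef p) * x).
Proof.
set a := lead_coef p => a0 p0.
have p_neq0 : p != 0.
  by apply: contraNneq a0; rewrite /a => ->; rewrite lead_coef0 rmorph0.
case sp : (size p) => [|d]; first by move/eqP: sp; rewrite size_poly_eq0 (negbTE p_neq0).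
have ad : p`_d = a by rewrite /a /lead_coef sp.
case: d sp ad => [|d] sp ad.
  move: p0; rewrite /evalat (size1_polyC (eq_leq sp)) map_polyC hornerC ad => e.
  by rewrite e eqxx in a0.
pose r := \poly_(i < d.+1) (p`_i * a ^+ (d - i)).
exists ('X^(d.+1) + r).
  by rewrite monicE lead_coefDl ?lead_coefXn // size_polyXn ltnS size_poly.
rewrite /root rmorphD /= map_polyXn hornerD hornerXn.
apply/eqP; transitivity (f a ^+ d * evalat p); last by rewrite p0 mulr0.
rewrite /evalat (horner_coef (map_poly f p)) size_map_poly_id0 // sp big_ord_recr /= coef_map ad.
rewrite mulrDr addrC; congr (_ + _); last first.
  by rewrite exprMn [f a ^+ d.+1]exprSr -mulrA.
rewrite (@horner_coef_wide _ d.+1); last first.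
  by apply: leq_trans (size_poly _ _); apply: size_poly.
rewrite big_distrr; apply: eq_bigr => i _ /=.
rewrite !coef_map /r coef_poly ltn_ord /= rmorphM rmorphXn exprMn.
have -> : f a ^+ d = f a ^+ (d - i) * f a ^+ i by rewrite -exprD subnK // -ltnS.
by ring.
Qed.

(** Every Horner step costs one more factor [f a], which turns the new [x] into the integral element
    [f a * x]. *)
Lemma integral_adjoin a (g : {poly A}) : integralOver f (f a * x) ->
  exists k, integralOver f (f a ^+ k * evalat g).
Proof.
move=> ax; elim/poly_ind: g => [|g c [k hk]].
  by exists 0%N; rewrite rmorph0 mulr0; apply: integral0.
exists k.+1; rewrite rmorphD rmorphM /= evalatC evalatX mulrDr.
have -> : f a ^+ k.+1 * (evalat g * x) = (f a ^+ k * evalat g) * (f a * x).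
  by rewrite exprSr; ring.
apply: integral_add; first exact: integral_mul.
by rewrite -rmorphXn -rmorphM; apply: integral_id.
Qed.

(** Divide [q] by ['X] until its constant term is nonzero in [E]; the equation then exhibits this
    term as a multiple of [evalat s]. *)
Lemma divides_constant (s q : {poly A}) : evalat s != 0 ->
  map_poly f q != 0 -> (map_poly f q).[evalat s] = 0 ->
  exists c w, f c != 0 /\ f c = evalat s * evalat w.
Proof.
move=> s0; elim/poly_ind: q => [|q c IH]; first by rewrite rmorph0 eqxx.
rewrite rmorphD rmorphM /= map_polyX map_polyC /= => q0.
rewrite hornerD hornerM hornerX hornerC.
have [c0|c0] := eqVneq (f c) 0.
  rewrite c0 addr0 => /eqP; rewrite mulf_eq0 (negbTE s0) orbF => /eqP; apply: IH.
  by apply: contraNneq q0 => ->; rewrite c0 mul0r addr0.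
move=> /eqP; rewrite addrC addr_eq0 => /eqP e; exists c, (- (q \Po s)).
split=> //; rewrite e rmorphN mulrN mulrC; congr (- (_ * _)).
by rewrite /= /evalat map_comp_poly horner_comp.
Qed.

(** The descent step of Zariski's lemma: [x] is algebraic, hence integral once a leading coefficient
    is inverted, and for an integral extension invertibility upstairs descends. *)
Lemma gdomain_adjoin : gdomain evalat ->
  gdomain f /\ exists p, map_poly f p != 0 /\ evalat p = 0.
Proof.
move=> gx; have [p [p0 px]] := gdomain_algebraic gx; split; last by exists p.
(* The map [f] may kill top coefficients of [p]; cutting at the size of the image leaves a leading
   coefficient with nonzero image. *)
pose p' := \poly_(i < size (map_poly f p)) p`_i.
have mp' : map_poly f p' = map_poly f p.
  apply/polyP => i; rewrite !coef_map coef_poly; case: ltnP => // /(nth_default 0).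
  by rewrite coef_map /= => ->; rewrite rmorph0.
have sp0 : (0 < size (map_poly f p))%N by rewrite size_poly_gt0.
have fp' : f p'`_(size (map_poly f p)).-1 != 0.
  by rewrite -coef_map mp' -[_`__]/(lead_coef _) lead_coef_eq0.
have sp' : size p' = size (map_poly f p).
  apply/anti_leq; rewrite size_poly /=.
  rewrite -(prednK sp0) ltnNge; apply/negP => le.
  by move: fp'; rewrite (nth_default 0 le) rmorph0 eqxx.
have fa : f (lead_coef p') != 0 by rewrite /lead_coef sp'.
have px' : evalat p' = 0 by rewrite /evalat mp'.
set a := lead_coef p' in fa.
have ax : integralOver f (f a * x) by apply: integral_scaled.
have [s [s0 hs]] := gx.
have [k [q mq rq]] := integral_adjoin s ax.
pose s1 := (a ^+ k)%:P * s.
have es1 : evalat s1 = f a ^+ k * evalat s by rewrite rmorphM /= evalatC rmorphXn.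
have [c [w [c0 cw]]] : exists c w, f c != 0 /\ f c = evalat s1 * evalat w.
  apply: (divides_constant (q := q)).
  - by rewrite es1 mulf_neq0 // expf_neq0.
  - by apply: monic_neq0; apply: monic_map.
  - by rewrite es1; apply/eqP.
(* Inverting [c] inverts [s], and inverting [a] makes [x] integral; so the product serves as the
   single element for [A]. *)
exists (c * a); split; first by rewrite rmorphM mulf_neq0.
move=> b b0.
have [t [g eg]] : exists t g, f c ^+ t = f b * evalat g.
  have [|t [g eg]] := hs b%:P; first by rewrite /= evalatC.
  exists t, ((a ^+ k)%:P ^+ t * w ^+ t * g); move: eg; rewrite /= evalatC => eg.
  by rewrite cw es1 !exprMn eg !rmorphM !rmorphXn /= !evalatC; ring.
have [l [q' mq' rq']] := integral_adjoin g ax.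
set y := f a ^+ l * evalat g in rq'.
have by_ : f b * y = f (c ^+ t * a ^+ l).
  by rewrite rmorphM !rmorphXn eg /y; ring.
have [d eqd] : exists d, size q' = d.+1.
  by exists (size q').-1; rewrite prednK // size_poly_gt0 monic_neq0.
(* Multiply the monic equation of [y] by the d-th power of [f b]: every term except the leading one
   keeps a factor [f b], and the powers of [f b * y] come from [A]. *)
have [h eh] : exists h, f (c ^+ t * a ^+ l) ^+ d = f b * f h.
  move: (c ^+ t * a ^+ l) by_ => C by_.
  exists (- \sum_(i < d) q'`_i * C ^+ i * b ^+ (d - i).-1).
  move: rq'; rewrite /root horner_coef size_map_poly_id0; last first.
    by rewrite (monicP mq') rmorph1 oner_eq0.
  rewrite eqd big_ord_recr /= !coef_map /=.
  have -> : q'`_d = 1 by rewrite -(monicP mq') /lead_coef eqd.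
  rewrite rmorph1 mul1r addrC addr_eq0 => /eqP e.
  rewrite -by_ exprMn e rmorphN !mulrN; congr (- _).
  rewrite rmorph_sum !big_distrr; apply: eq_bigr => i _ /=.
  rewrite !rmorphM !rmorphXn /= -by_.
  have -> : f b ^+ d = f b * f b ^+ (d - i).-1 * f b ^+ i.
    by rewrite -exprS prednK ?subn_gt0 // -exprD subnK // ltnW.
  rewrite coef_map exprMn [(f b * y) ^+ i]exprMn /=; rewrite /y exprMn; ring.
exists ((t + l) * d)%N, (h * (a ^+ t * c ^+ l) ^+ d).
rewrite [f (h * _)]rmorphM mulrA -eh -rmorphXn -rmorphXn -rmorphM; congr (f _).
by rewrite exprM -exprMn; congr (_ ^+ d); rewrite exprMn !exprD; ring.
Qed.

End Adjoin.

(** The base ring changes to [{poly A}] with each generator, so the descent treats one generator at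
    a time over an arbitrary ring. *)
Fixpoint generates (xs : seq E) : forall (A : comNzRingType), {rmorphism A -> E} -> Prop :=
  if xs is x :: xs' then fun A f => generates xs' (evalat f x)
  else fun A f => forall e, exists a, f a = e.

Lemma generates_intro xs (A : comNzRingType) (f : {rmorphism A -> E}) :
  (forall S : E -> Prop, (forall u v, S u -> S v -> S (u + v)) ->
     (forall u v, S u -> S v -> S (u * v)) ->
     (forall a, S (f a)) -> (forall x, x \in xs -> S x) -> forall e, S e) ->
  generates xs f.
Proof.
elim: xs A f => [|x xs IH] A f h /=.
  move=> e; apply: (h (fun e => exists a, f a = e)) => //.
  - by move=> _ _ [a <-] [b <-]; exists (a + b); rewrite rmorphD.
  - by move=> _ _ [a <-] [b <-]; exists (a * b); rewrite rmorphM.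
  - by move=> a; exists a.
apply: IH => S SD SM Sf Sx; apply: h => //.
  by move=> a; rewrite -(evalatC f x); apply: Sf.
by move=> y; rewrite inE => /orP[/eqP ->|/Sx//]; rewrite -(evalatX f x); apply: Sf.
Qed.

Lemma generates_gdomain xs (A : comNzRingType) (f : {rmorphism A -> E}) :
  generates xs f -> gdomain f.
Proof.
elim: xs A f => [|x xs IH] A f /=; last by move=> /IH/gdomain_adjoin[].
move=> h; exists 1; rewrite rmorph1 oner_neq0; split=> // b b0.
have [c ec] := h (f b)^-1.
by exists 0%N, c; rewrite expr0 ec mulfV.
Qed.

Lemma generates_algebraic x xs (A : comNzRingType) (f : {rmorphism A -> E}) :
  generates (x :: xs) f -> exists p, map_poly f p != 0 /\ (map_poly f p).[x] = 0.
Proof. by rewrite /= => /generates_gdomain/gdomain_adjoin[]. Qed.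

End Zariski.

(** * Residue fields of maximal ideals *)

Section ResidueField.
Variables (R : comNzRingType) (M : R -> Prop).
Hypothesis maxM : maximal_ideal M.

Definition in_ideal : pred R := fun x => pbool (M x).

Lemma in_idealP x : reflect (M x) (x \in in_ideal).
Proof. by rewrite unfold_in /in_ideal /pbool; case: excluded_middle_informative => h; constructor. Qed.

Lemma in_ideal_closed : idealr_closed in_ideal.
Proof.
have [iM [M1 _]] := maxM; split; [by apply/in_idealP; exact: is_ideal0|by apply/negP => /in_idealP|].
move=> a u v /in_idealP Mu /in_idealP Mv; apply/in_idealP.
by apply: is_idealD => //; apply: is_idealMl.
Qed.

HB.instance Definition _ := isIdealr.Build R in_ideal in_ideal_closed.

Definition residue_ideal : idealr R := in_ideal.
Definition residue_ring := {ideal_quot residue_ideal}.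
HB.instance Definition _ := GRing.ComNzRing.on residue_ring.

Local Open Scope quotient_scope.

Lemma residue_eq0 (x : R) : (\pi_residue_ring x == 0) = (x \in in_ideal).
Proof. by rewrite -[0](rmorph0 (\pi_residue_ring)) -Quotient.idealrBE subr0. Qed.


(** The condition stands under the existential so that choice yields a total inverse. *)
Lemma residue_inverse (x : residue_ring) : exists y : residue_ring, x != 0 -> y * x = 1.
Proof.
have ex : x = \pi_residue_ring (repr x) by rewrite reprK.
have [m|nm] := boolP (repr x \in in_ideal).
  by exists 0; rewrite ex residue_eq0 m.
have [y hy] : exists y, M (1 - y * repr x) by apply: maximal_inv => // /in_idealP; apply/negP.
exists (\pi_residue_ring y) => _; rewrite {1}ex -rmorphM -(rmorph1 \pi_residue_ring).
apply/eqP; rewrite eq_sym -subr_eq0 -rmorphB residue_eq0; exact/in_idealP.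
Qed.

Definition residue_inv (x : residue_ring) : residue_ring :=
  if x == 0 then 0
  else proj1_sig (constructive_indefinite_description _ (residue_inverse x)).

Lemma residue_mulVf (x : residue_ring) : x != 0 -> residue_inv x * x = 1.
Proof.
rewrite /residue_inv; case: constructive_indefinite_description => y /= hy x0.
by rewrite (negbTE x0) hy.
Qed.

Lemma residue_inv0 : residue_inv 0 = 0.
Proof.
by rewrite /residue_inv; case: constructive_indefinite_description => y _ /=; rewrite eqxx.
Qed.

HB.instance Definition _ := GRing.ComNzRing_isField.Build residue_ring
  residue_mulVf residue_inv0.

Definition residue_pi (x : R) : residue_ring := \pi_residue_ring x.
HB.instance Definition _ := GRing.RMorphism.copy residue_pi (\pi_residue_ring : R -> _).

Lemma residue_piP x : residue_pi x = 0 <-> M x.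
Proof.
split; first by move/eqP; rewrite residue_eq0 => /in_idealP.
by move=> Mx; apply/eqP; rewrite residue_eq0; apply/in_idealP.
Qed.

Lemma residue_pi_surj (e : residue_ring) : exists x, residue_pi x = e.
Proof. by exists (repr e); rewrite /residue_pi reprK. Qed.

End ResidueField.

Lemma zariski (K : fieldType) (N : nat) (M : {mpoly K[N]} -> Prop) (i : 'I_N) :
  maximal_ideal M -> exists p : {poly K}, p != 0 /\ M (map_poly (@mpolyC N K) p).['X_i].
Proof.
move=> maxM; pose E : fieldType := residue_ring maxM.
pose pi : {rmorphism {mpoly K[N]} -> E} := residue_pi maxM.
pose f : {rmorphism K -> E} := (pi \o @mpolyC N K).
(* The variable in question comes first, and once more among the others: only the first generator is
   adjoined directly to [K], so only for it is algebraicity over [K] obtained. *)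
have gen : generates (pi 'X_i :: [seq pi 'X_j | j : 'I_N]) f.
  apply: generates_intro => S SD SM Sf Sx e.
  have [p <-] := residue_pi_surj e.
  elim/mpoly_gen_ind: p => [c|j|p q Sp Sq|p q Sp Sq].
  - exact: Sf.
  - by apply: Sx; rewrite inE; apply/orP; right; apply/imageP; exists j.
  - by rewrite rmorphD; apply: SD.
  - by rewrite rmorphM; apply: SM.
have [p [p0 e]] := generates_algebraic gen; exists p; split.
  by apply: contraNneq p0 => ->; rewrite rmorph0.
apply/(residue_piP maxM); rewrite -[RHS]e.
have -> : map_poly f p = map_poly pi (map_poly (@mpolyC N K) p).
  by apply/polyP => k; rewrite !coef_map.
by rewrite horner_map.
Qed.

(** * Regular sequences of symmetric polynomials *)

Section Expansion.
Variables (K : fieldType) (N : nat).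
Local Notation R := {mpoly K[N]}.
Implicit Types (Q : R -> Prop) (i j : 'I_N) (h : R).

(** The coefficients do not involve ['X_i] but are kept in the full ring, so that ideals of that
    ring can be applied to them. *)
Definition expand i : R -> {poly R} :=
  mmap (polyC \o @mpolyC N K) (fun j => if j == i then 'X else ('X_j)%:P).

HB.instance Definition _ i := GRing.RMorphism.copy (expand i)
  (mmap (polyC \o @mpolyC N K) (fun j => if j == i then 'X else ('X_j)%:P)).

Lemma expandD i : {morph expand i : p q / p + q}. Proof. exact: rmorphD. Qed.
Lemma expandM i : {morph expand i : p q / p * q}. Proof. exact: rmorphM. Qed.
Lemma expandC i c : expand i c%:MP = c%:MP%:P. Proof. exact: mmapC. Qed.
Lemma expandX i j : expand i 'X_j = if j == i then 'X else ('X_j)%:P.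
Proof. by rewrite /expand mmapX mmap1U. Qed.

Lemma expandK i h : (expand i h).['X_i] = h.
Proof.
elim/mpoly_gen_ind: h => [c|j|p q ep eq|p q ep eq].
- by rewrite expandC hornerC.
- by rewrite expandX; case: eqP => [->|_]; rewrite ?hornerX ?hornerC.
- rewrite expandD hornerD; congr (_ + _); [exact: ep|exact: eq].
- rewrite expandM hornerM; congr (_ * _); [exact: ep|exact: eq].
Qed.

Lemma kill_expand (F : {set 'I_N}) i h : i \in F ->
  map_poly (kill F) (expand i h) = expand i (kill F h).
Proof.
move=> iF; elim/mpoly_gen_ind: h => [c|j|p q ep eq|p q ep eq].
- by rewrite killC !expandC map_polyC /= killC.
- rewrite expandX killX; case: eqP => [->|ji]; first by rewrite iF expandX eqxx map_polyX.
  rewrite map_polyC /= killX; case: ifP => _; last by rewrite polyC0 rmorph0.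
  by rewrite expandX; case: eqP.
- rewrite (killD F p q) (expandD i p q) (expandD i (kill F p)) rmorphD /=.
  by congr (_ + _); [exact: ep|exact: eq].
- rewrite (killM F p q) (expandM i p q) (expandM i (kill F p)) rmorphM /=.
  by congr (_ * _); [exact: ep|exact: eq].
Qed.

(** For an ideal this says that it is extended from the polynomials without ['X_i], so that the
    quotient is a polynomial ring in ['X_i]. *)
Definition xfree i Q := forall h, Q h -> forall a, Q (expand i h)`_a.

Lemma xfree_coef i Q h : is_ideal Q -> (forall a, Q (expand i h)`_a) -> Q h.
Proof.
move=> iQ hQ; rewrite -(expandK i h) horner_coef.
by apply: is_ideal_sum => // a _; apply: is_idealMr.
Qed.

Definition univ (p : {poly K}) i : R := (map_poly (@mpolyC N K) p).['X_i].

Lemma univ_MXaddC p c i : univ (p * 'X + c%:P) i = univ p i * 'X_i + c%:MP.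
Proof.
rewrite /univ rmorphD rmorphM /= map_polyX map_polyC /=.
by rewrite hornerD hornerM hornerX hornerC.
Qed.

Lemma univ0 i : univ 0 i = 0. Proof. by rewrite /univ rmorph0 horner0. Qed.

Lemma univX i : univ 'X i = 'X_i. Proof. by rewrite /univ map_polyX hornerX. Qed.

Lemma univMX p i : univ (p * 'X) i = univ p i * 'X_i.
Proof. by have := univ_MXaddC p 0 i; rewrite polyC0 mpolyC0 !addr0. Qed.

Lemma expand_univ p i : expand i (univ p i) = map_poly (@mpolyC N K) p.
Proof.
elim/poly_ind: p => [|p c IH]; first by rewrite univ0 !rmorph0.
rewrite univ_MXaddC expandD expandM expandX eqxx expandC IH.
by rewrite rmorphD rmorphM /= map_polyX map_polyC.
Qed.

Lemma expand_univ_neq p i j : j != i -> expand i (univ p j) = (univ p j)%:P.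
Proof.
move=> ji; elim/poly_ind: p => [|p c IH]; first by rewrite univ0 rmorph0 polyC0.
rewrite univ_MXaddC expandD expandM expandX (negbTE ji) expandC IH.
by rewrite polyCD polyCM.
Qed.

(** The coefficients of [h] enter [Q] from the top down, because the leading coefficient of [p] is a
    unit. *)
Lemma xfree_nzd i Q p : is_ideal Q -> xfree i Q -> p != 0 -> nzd Q (univ p i).
Proof.
move=> iQ fQ p0 h /fQ; rewrite expandM expand_univ => hc.
apply: (@xfree_coef i) => //; set H := expand i h in hc *.
set d := (size p).-1.
have sp : (size p = d.+1)%N by rewrite prednK // size_poly_gt0.
suff ind n : forall a, (size H <= a + n)%N -> Q H`_a.
  by move=> a; apply: (ind (size H)); rewrite leq_addl.
elim: n => [|n IH] a.
  by rewrite addn0 => /(nth_default 0) ->; apply: is_ideal0.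
move=> san; have := hc (a + d)%N; rewrite coefM.
have ad : (a < (a + d).+1)%N by lia.
rewrite (bigD1 (Ordinal ad)) //= addKn coef_map /= => hq.
set rest := (X in _ + X) in hq.
have Qrest : Q rest.
  apply: is_ideal_sum => // j ja; rewrite coef_map /=.
  case: (ltngtP j a) => [lt|gt|e]; last by rewrite -val_eqE /= e eqxx in ja.
    rewrite (@nth_default _ 0 p) ?mpolyC0 ?mulr0; first exact: is_ideal0.
    by rewrite sp; lia.
  by apply: is_idealMr => //; apply: IH; lia.
have : Q (H`_a * (p`_d)%:MP).
  by rewrite -[_ * _](addrK rest); apply: is_idealB.
move/(is_idealMr (p`_d)^-1%:MP iQ); rewrite -mulrA -mpolyCM mulfV ?mulr1 //.
by rewrite -[_`__]/(lead_coef p) lead_coef_eq0.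
Qed.

Lemma xfree_addgen i Q g : xfree i Q -> expand i g = g%:P -> xfree i (addgen Q g).
Proof.
move=> fQ eg _ [q [u [Qq ->]]] a; rewrite expandD expandM eg coefD coefMC.
by exists (expand i q)`_a, (expand i u)`_a; split=> //; apply: fQ.
Qed.

Lemma xfree_gen i (S : R -> Prop) :
  (forall g, S g -> expand i g = g%:P) -> xfree i (ideal_gen S).
Proof.
move=> eS h; move: h; have iS := is_ideal_gen S.
apply: ideal_gen_sub.
  split; first by move=> a; rewrite rmorph0 coef0; apply: is_ideal0.
  split; first by move=> x y hx hy a; rewrite expandD coefD; exact: (is_idealD iS (hx a) (hy a)).
  move=> c x hx a; rewrite expandM coefM; apply: (is_ideal_sum _ iS) => j _.
  exact: (is_idealMl _ iS (hx _)).
move=> g Sg a; rewrite eS // coefC; case: ifP => _; last exact: is_ideal0.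
exact: mem_ideal_gen.
Qed.

Lemma xfree_vprime (F : {set 'I_N}) i : i \in F -> xfree i (vprime F).
Proof.
move=> iF h hF a; rewrite /vprime -coef_map kill_expand // hF rmorph0.
by rewrite coef0.
Qed.

End Expansion.

Section NonzeroDivisors.
Variable R : comNzRingType.
Implicit Types (Q : R -> Prop) (f g : R).

Lemma nzdM Q f g : nzd Q f -> nzd Q g -> nzd Q (f * g).
Proof. by move=> nf ng h; rewrite mulrA => /ng/nf. Qed.

Lemma nzd_prod (I : eqType) (s : seq I) (y : I -> R) Q : 
  (forall i, i \in s -> nzd Q (y i)) -> nzd Q (\prod_(i <- s) y i).
Proof.
elim: s => [|i s IH] hy; first by move=> h; rewrite big_nil mulr1.
rewrite big_cons; apply: nzdM; first by apply: hy; rewrite inE eqxx.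
by apply: IH => j js; apply: hy; rewrite inE js orbT.
Qed.

Lemma nzd_congr Q f g : is_ideal Q -> Q (f - g) -> nzd Q g -> nzd Q f.
Proof.
move=> iQ fg ng h hf; apply: ng.
have -> : h * g = h * f - h * (f - g) by ring.
by apply: is_idealB => //; apply: is_idealMl.
Qed.

Lemma addgen_congr Q f g : is_ideal Q -> Q (f - g) -> eqI (addgen Q f) (addgen Q g).
Proof.
move=> iQ fg x; split=> -[a [u [Qa ->]]].
  exists (a + u * (f - g)), u; split; last by ring.
  by apply: is_idealD => //; apply: is_idealMl.
exists (a - u * (f - g)), u; split; last by ring.
by apply: is_idealB => //; apply: is_idealMl.
Qed.

End NonzeroDivisors.

Section SymmetricSequence.
Variables (K : fieldType) (N : nat).
Local Notation R := {mpoly K[N]}.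
Variable q : 'I_N -> {poly K}.
Hypothesis q_neq0 : forall i, q i != 0.

(** The factor ['X] puts [yv i] into every ideal that contains ['X_i]; [q i] stays free in order to
    put it into a given maximal ideal. *)
Definition yv i : R := univ (q i * 'X) i.

Definition elem_sym k : R := \sum_(S : {set 'I_N} | #|S| == k) \prod_(i in S) yv i.

Fixpoint elem_syms d : seq R := if d is d'.+1 then elem_sym d :: elem_syms d' else [::].

Lemma size_elem_syms d : size (elem_syms d) = d.
Proof. by elim: d => //= d ->. Qed.

Lemma mem_elem_syms (I : R -> Prop) d f : is_ideal I -> (forall i, I (yv i)) ->
  f \in elem_syms d -> I f.
Proof.
move=> iI Iy; elim: d => //= d IH; rewrite inE => /orP[/eqP ->|/IH//].
apply: is_ideal_sum => // S /eqP cS.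
have [i iS] : exists i, i \in S by apply/set0Pn; rewrite -card_gt0 cS.
by rewrite (bigD1 i) //=; apply: is_idealMr.
Qed.

(** Every other index set of the same size leaves [F], so its product has a factor in [Q]. *)
Lemma elem_sym_mod (Q : R -> Prop) (F : {set 'I_N}) : is_ideal Q ->
  (forall i, i \notin F -> Q (yv i)) -> Q (elem_sym #|F| - \prod_(i in F) yv i).
Proof.
move=> iQ hQ; rewrite /elem_sym (bigD1 F) //= addrC addrK.
apply: is_ideal_sum => // S /andP[/eqP cS SF].
have [i iS iF] : exists2 i, i \in S & i \notin F.
  by apply/subsetPn; apply: contra SF => sub; rewrite eqEcard sub cS leqnn.
by rewrite (bigD1 i) //=; apply: is_idealMr => //; apply: hQ.
Qed.

(* Modulo [Q] the first form is the product of the [y_i], [i] in [F], and modulo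
   each single [y_i] the remaining ones are the forms for [F :\ i]. *)
Lemma wreg_elem_syms n (F : {set 'I_N}) (Q : R -> Prop) : #|F| = n -> is_ideal Q ->
  (forall i, i \in F -> xfree i Q) -> (forall i, i \notin F -> Q (yv i)) ->
  wreg Q (elem_syms n).
Proof.
elim: n F Q => [//|n IH] F Q cF iQ fQ yQ.
have em := elem_sym_mod iQ yQ; rewrite cF in em.
have ny i : i \in F -> nzd Q (yv i).
  move=> iF; apply: xfree_nzd => //; first exact: fQ.
  by rewrite mulf_neq0 ?polyX_eq0.
split.
  apply: nzd_congr em _ => //; rewrite -big_enum; apply: nzd_prod => i.
  by rewrite mem_enum; apply: ny.
apply: (wreg_ext (fun x => iff_sym (addgen_congr iQ em x))).
rewrite -big_enum.
(* Peel off the product one factor at a time: Q + (y_i P) has colon Q + (P) by y_i, and its sum with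
   y_i is Q + (y_i). The empty product gives the unit ideal. *)
have : {subset enum F <= F} by move=> i; rewrite mem_enum.
elim: (enum F) => [|i s IHs] sF.
  by rewrite big_nil; apply: wreg1; [exact: addgen_gen|exact: is_ideal_addgen].
have iF : i \in F by apply: sF; rewrite inE eqxx.
rewrite big_cons /=; set P := \prod_(j <- s) yv j in IHs *.
apply: (@wreg_colon _ _ (addgen Q P) (yv i)); try exact: is_ideal_addgen.
- move=> h; split.
    move=> [a [u [Qa e]]]; exists (h - u * P), u; split; last by ring.
    apply: (ny i iF); suff -> : (h - u * P) * yv i = a by [].
    by rewrite -[RHS](addrK (u * (yv i * P))) -e; ring.
  move=> [a [u [Qa ->]]]; exists (a * yv i), u; split; first exact: is_idealMr.
  by ring.
- by apply: IHs => j js; apply: sF; rewrite inE js orbT.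
have iQi := is_ideal_addgen (yv i) iQ.
apply: (@wreg_ext _ (addgen Q (yv i))).
  move=> x; split; first by apply: addgen_mono => z; apply: addgen_l.
  apply: addgen_sub => //; last exact: addgen_gen.
  apply: addgen_sub => //; first by move=> z; apply: addgen_l.
  by apply: is_idealMr => //; apply: addgen_gen.
apply: (IH (F :\ i)) => //.
- by move: cF; rewrite (cardsD1 i) iF => -[].
- move=> j; rewrite in_setD1 => /andP[ji jF]; apply: xfree_addgen; first exact: fQ.
  by apply: expand_univ_neq; rewrite eq_sym.
- move=> j; rewrite in_setD1 negb_and negbK => /orP[/eqP ->|/yQ]; first exact: addgen_gen.
  exact: addgen_l.
Qed.

Lemma vprime_yv (F : {set 'I_N}) i : i \notin F -> vprime F (yv i).
Proof.
move=> iF; rewrite /yv univMX; apply: is_idealMl; last exact/vprimeX.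
exact/prime_is_ideal/vprime_prime.
Qed.

Lemma wreg_vprime (F : {set 'I_N}) : wreg (vprime F) (elem_syms #|F|).
Proof.
apply: (wreg_elem_syms (F := F)) => //; first exact/prime_is_ideal/vprime_prime.
  by move=> i; apply: xfree_vprime.
by move=> i; apply: vprime_yv.
Qed.

End SymmetricSequence.

(** * Heights and independence complexes *)

Section Heights.
Variables (K : fieldType) (N : nat).
Local Notation R := {mpoly K[N]}.
Implicit Types (I P : R -> Prop) (F : {set 'I_N}).

Lemma chain_over_bottom I P (c : nat -> R -> Prop) k :
  prime_chain_over I P c k -> has_chain (c 0%N) P k.
Proof.
move=> [h [hs e]]; exists c; split=> // t tk; split; first by case: (h t tk).
elim: t tk => [|t IH] tk x // cx.
by have [sub _] := hs t tk; apply/sub/IH => //; apply: ltnW.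
Qed.

Lemma vprimeT_chain I P k : has_chain I P k -> has_chain (vprime setT) P k.
Proof.
move=> [c [h hc]]; exists c; split=> // t /h[pc _]; split=> //.
apply: vprime_sub; first exact: prime_is_ideal.
by move=> i; rewrite in_setT.
Qed.

Lemma chain_to_vprime F : has_chain (fun _ : R => False) (vprime F) (N - #|F|).
Proof.
have [n] := ubnP (N - #|F|); elim: n F => // n IH F lt.
have cF : (#|F| <= N)%N by rewrite -[N in (_ <= N)%N]card_ord max_card.
have [FT|FT] := eqVneq F setT.
  have -> : (N - #|F| = 0)%N by rewrite FT cardsT card_ord subnn.
  by apply: has_chain0 => //; apply: vprime_prime.
have [i _ iF] : exists2 i, i \in setT & i \notin F.
  by apply/subsetPn; rewrite subTset.
have cFi : #|i |: F| = #|F|.+1 by rewrite cardsU1 iF.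
have cFi' : (#|i |: F| <= N)%N by rewrite -[N in (_ <= N)%N]card_ord max_card.
have -> : (N - #|F| = (N - #|i |: F|).+1)%N by rewrite cFi; lia.
apply: (@has_chain_rcons _ _ (vprime (i |: F))).
- by apply: IH; rewrite cFi; lia.
- exact: vprime_prime.
split; first by apply: vprime_mono; apply: subsetUr.
exists 'X_i; split; first exact/vprimeX.
by move/vprimeX; rewrite setU11.
Qed.

Lemma chain_from_vprime I F k : has_chain I (vprime F) k ->
  has_chain I (vprime (set0 : {set 'I_N})) (k + #|F|).
Proof.
have [n] := ubnP #|F|; elim: n F k => // n IH F k lt hc.
have [F0|/set0Pn[i iF]] := eqVneq F set0.
  by move: hc; rewrite F0 cards0 addn0.
have cF : #|F| = #|F :\ i|.+1 by rewrite (cardsD1 i) iF.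
rewrite cF addnS -addSn; apply: IH; first by lia.
apply: has_chain_rcons hc _ _; first exact: vprime_prime.
split; first by apply: vprime_mono; apply: subsetDl.
exists 'X_i; split; first by apply/vprimeX; rewrite in_setD1 eqxx.
by move/vprimeX; rewrite iF.
Qed.

(** For the upper bound, a chain ending at [vprime F] is continued by |F| steps to the ideal of all
    variables, and no chain is longer than [N]. *)
Lemma prime_height_vprime F : prime_height (@vprime K N F) (N - #|F|).
Proof.
split; first exact: chain_to_vprime.
move=> c k hc; have /chain_from_vprime/vprimeT_chain h : has_chain (fun _ : R => False) (vprime F) k.
  by exists c.
have := dim_bound (fun x (hx : vprime setT x) => hx) h.
by rewrite cardsT card_ord; lia.
Qed.

(** Dimension certified by coordinate subspaces: the zero set of [I] contains one of dimension [d]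
    and is covered by those of dimension at most [d]. *)
Definition has_dim I d :=
  (exists2 F : {set 'I_N}, #|F| = d & subI I (vprime F)) /\
  (forall P, prime_ideal P -> subI I P ->
     exists2 F : {set 'I_N}, (#|F| <= d)%N & subI (vprime F) P).

Lemma has_dim_le I d : has_dim I d -> (d <= N)%N.
Proof. by move=> [[F <- _] _]; rewrite -[N in (_ <= N)%N]card_ord max_card. Qed.

Lemma has_dim_height I d : has_dim I d -> ideal_height I (N - d).
Proof.
move=> [[F cF IF] hd]; split.
  exists (vprime F); split; first exact: vprime_prime.
  by split=> //; rewrite -cF; apply: prime_height_vprime.
move=> P h pP IP [_ hP]; have [G cG GP] := hd P pP IP.
have [c hc] := has_chain_last (chain_to_vprime G) pP GP.
by have := hP _ _ hc; lia.
Qed.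

(** Grade and height are squeezed: every regular sequence in [M] yields a chain of the same length,
    [dim_bound] caps chains at [d], and the symmetric polynomials attain [d]. *)
Lemma has_dim_CM I d : is_ideal I -> has_dim I d ->
  (forall q : 'I_N -> {poly K}, (forall i, q i != 0) -> wreg I (elem_syms q d)) ->
  CM_quot I.
Proof.
move=> iI [_ hd] wI M maxM IM; exists d.
have pM := maximal_prime maxM; have iM := prime_is_ideal pM.
have bound k : has_chain I M k -> (k <= d)%N.
  move=> [c hc]; have [h [_ _]] := hc; have [p0 I0] := h 0%N isT.
  have [F cF F0] := hd _ p0 I0.
  exact: leq_trans (dim_bound F0 (chain_over_bottom hc)) cF.
pose q i := proj1_sig (constructive_indefinite_description _ (zariski i maxM)).
have qP i : q i != 0 /\ M (univ (q i) i).
  by rewrite /q; case: constructive_indefinite_description.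
have q0 i : q i != 0 by case: (qP i).
have fM f : f \in elem_syms q d -> M f.
  apply: mem_elem_syms => // i; rewrite /yv univMX; apply: is_idealMr => //.
  by case: (qP i).
have wfs := wI q q0.
have chain := wreg_chain iI pM IM fM wfs; rewrite size_elem_syms in chain.
split; split.
- exists (elem_syms q d); split; last exact: size_elem_syms.
  split; first exact: fM.
  split; first exact/(wregP _ iI).
  move=> h; apply: (prime_not1 pM); move: h; apply: ideal_gen_sub => // x [/IM//|].
  exact: ideal_gen_sub.
- move=> fs [fsM [/(wregP _ iI) wf _]]; apply: bound.
  exact: wreg_chain.
- by case: chain => c hc; exists c.
- by move=> c k hc; apply: bound; exists c.
Qed.

End Heights.

(** * Vertex decomposable graphs *)

Section IndependenceComplexes.
Variables (V : finType) (e : rel V).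
Hypotheses (e_sym : ssrbool.symmetric e) (e_irr : irreflexive e).
Implicit Types (U S F : {set V}).

Definition indep S := [forall a in S, forall b in S, ~~ e a b].

Lemma indepP S : reflect (forall a b, a \in S -> b \in S -> ~~ e a b) (indep S).
Proof.
apply: (iffP forall_inP) => h; first by move=> a b /h/forall_inP; apply.
by move=> a aS; apply/forall_inP => b; apply: h.
Qed.

Lemma indepW S F : S \subset F -> indep F -> indep S.
Proof.
by move=> /subsetP SF /indepP h; apply/indepP => a b /SF aF /SF bF; apply: h.
Qed.

Definition nbhd v := [set w | e v w].

(** The index is the common size of all maximal independent sets. Carrying it along makes purity and
    both dimension conditions of vertex decomposability automatic. *)
Inductive vdec_graph : {set V} -> nat -> Prop :=
| sg_indep U : indep U -> vdec_graph U #|U|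
| sg_step U v d : v \in U -> vdec_graph (U :\ v) d.+1 ->
    vdec_graph (U :\: (v |: nbhd v)) d -> vdec_graph U d.+1.

Lemma indepU1 v S : (indep (v |: S)) = indep S && [disjoint S & nbhd v].
Proof.
apply/indepP/andP => [h|[/indepP hS dS] a b].
  split; first by apply/indepP => a b aS bS; apply: h; rewrite inE ?aS ?bS orbT.
  rewrite disjoint_subset; apply/subsetP => a aS; rewrite !inE.
  by apply: h; rewrite ?setU11 // inE aS orbT.
have nS w : w \in S -> ~~ e v w.
  by move=> wS; have := disjointFr dS wS; rewrite inE => ->.
rewrite !inE => /orP[/eqP ->|aS] /orP[/eqP ->|bS]; first by rewrite e_irr.
- exact: nS.
- by rewrite e_sym; apply: nS.
- exact: hS.
Qed.

Lemma sg_max_indep U d : vdec_graph U d ->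
  (exists2 S : {set V}, S \subset U & indep S /\ #|S| = d) /\
  (forall S : {set V}, S \subset U -> indep S -> (#|S| <= d)%N).
Proof.
elim=> {U d} [U iU|U v d vU _ [[S SU [iS cS]] mS] _ [_ mL]].
  by split; [exists U|move=> S /subset_leq_card].
split; first by exists S => //; apply: subset_trans SU (subsetDl _ _).
move=> F FU iF; have [vF|vF] := boolP (v \in F); last first.
  by apply: mS iF; rewrite subsetD1 FU.
rewrite (cardsD1 v) vF ltnS; apply: mL; last by apply: indepW iF; apply: subsetDl.
move: iF; rewrite -{1}(setD1K vF) indepU1 => /andP[_ dF].
apply/subsetP => w wF; rewrite !inE negb_or.
have := disjointFr dF wF; rewrite inE => ->.
by move: wF; rewrite !inE => /andP[-> /(subsetP FU) ->].
Qed.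

Definition indep_complex U := [set F : {set V} | (F \subset U) && indep F].

Lemma link_indep U v : v \in U ->
  link (indep_complex U) v = indep_complex (U :\: (v |: nbhd v)).
Proof.
move=> vU; apply/setP => F; rewrite !inE indepU1 subUset sub1set vU /=.
have [FU|FU] /= := boolP (F \subset U); last first.
  by symmetry; apply/negP => /andP[h _]; case/negP: FU; apply: subset_trans h (subsetDl _ _).
rewrite setDUr subsetI !subsetD FU /= [[disjoint F & [set v]]]disjoint_sym disjoints1.
by case: (v \in F); case: (indep F); rewrite /= ?andbT ?andbF.
Qed.

Lemma deletion_indep U v : deletion (indep_complex U) v = indep_complex (U :\ v).
Proof.
by apply/setP => F; rewrite !inE subsetD1 andbAC.
Qed.

Lemma sg_facets U d : vdec_graph U d ->
  forall F, facet (indep_complex U) F -> #|F| = d.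
Proof.
elim=> {U d} [U iU F|U v d vU _ hD _ hL F] /andP[].
  rewrite inE => /andP[FU _] /forall_inP/(_ U).
  by rewrite inE subxx iU FU => /(_ isT)/eqP ->.
rewrite inE => /andP[FU iF] /forall_inP mF.
have [vF|vF] := boolP (v \in F); last first.
  apply: hD; rewrite /facet inE subsetD1 FU vF iF /=.
  apply/forall_inP => G; rewrite inE subsetD1 => /andP[/andP[GU _] iG].
  by apply: mF; rewrite inE GU.
rewrite (cardsD1 v) vF; congr _.+1.
apply: hL; rewrite -(link_indep vU) /facet !inE eqxx setD1K // FU iF /= andbT.
rewrite (subset_trans (subsetDl _ _) FU) (indepW (subsetDl _ _) iF) /=.
apply/forall_inP => G; rewrite !inE => /andP[_ /andP[vG vGi]].
apply/implyP => FG; have /implyP h : (F \subset v |: G) ==> (v |: G == F).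
  by apply: mF; rewrite inE.
have /eqP eFG : v |: G == F.
  by apply: h; rewrite -(setD1K vF); apply: setUS.
by rewrite -eFG setU1K.
Qed.

Lemma sg_maxcard U d : vdec_graph U d -> maxcard (indep_complex U) = d.
Proof.
move=> /sg_max_indep[[S SU [iS cS]] mS]; apply/anti_leq/andP; split.
  by apply/bigmax_leqP => F; rewrite inE => /andP[FU iF]; apply: mS.
by rewrite -cS; apply: (leq_bigmax_cond (F := fun F : {set V} => #|F|)); rewrite inE SU.
Qed.

Lemma sg_vertex_decomposable U d : vdec_graph U d ->
  vertex_decomposable (indep_complex U).
Proof.
have pureP W k : vdec_graph W k -> pure (indep_complex W).
  by move=> sW F G fF fG; rewrite (sg_facets sW fF) (sg_facets sW fG).
elim=> {U d} [U iU|U v d vU sD vD sL vL].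
  apply: (vd_simplex (F := U)); apply/setP => F; rewrite !inE.
  by case: (boolP (F \subset U)) => // FU; rewrite (indepW FU iU).
have sU := sg_step vU sD sL.
apply: (vd_step (k := v)); rewrite ?(link_indep vU) ?deletion_indep //.
- rewrite inE sub1set vU; apply/indepP => a b; rewrite !inE => /eqP -> /eqP ->.
  by rewrite e_irr.
- exact: pureP sL.
- exact: pureP sD.
- by rewrite (sg_maxcard sU) (sg_maxcard sD).
- by rewrite (sg_maxcard sU) (sg_maxcard sL).
Qed.

End IndependenceComplexes.

(** * Edge ideals *)

Section EdgeIdeals.
Variables (K : fieldType) (N : nat) (e : rel 'I_N).
Hypotheses (e_sym : ssrbool.symmetric e) (e_irr : irreflexive e).
Local Notation R := {mpoly K[N]}.
Implicit Types (Z U F : {set 'I_N}).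

(** [Z] collects the neighbours that become generators in links; indices outside [Z] and [U] are
    free variables, so all ideals of the recursion live in one ring. *)
Definition edge_gen Z U (x : R) :=
  (exists2 w, w \in Z & x = 'X_w) \/
  (exists a b, [/\ a \in U, b \in U, e a b & x = 'X_a * 'X_b]).

Definition edge_ideal Z U : R -> Prop := ideal_gen (edge_gen Z U).

Lemma is_ideal_edge Z U : is_ideal (edge_ideal Z U).
Proof. exact: is_ideal_gen. Qed.

Lemma edge_idealX Z U w : w \in Z -> edge_ideal Z U 'X_w.
Proof. by move=> wZ; apply: mem_ideal_gen; left; exists w. Qed.

Lemma edge_idealXX Z U a b : a \in U -> b \in U -> e a b -> edge_ideal Z U ('X_a * 'X_b).
Proof. by move=> aU bU ab; apply: mem_ideal_gen; right; exists a, b. Qed.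

Lemma edge_ideal_sub (I : R -> Prop) Z U : is_ideal I ->
  (forall w, w \in Z -> I 'X_w) ->
  (forall a b, a \in U -> b \in U -> e a b -> I ('X_a * 'X_b)) ->
  subI (edge_ideal Z U) I.
Proof.
move=> iI hZ hU; apply: ideal_gen_sub => // x [[w wZ ->]|[a [b [aU bU ab ->]]]].
  exact: hZ.
exact: hU.
Qed.

Lemma edge_ideal_indep Z U : indep e U -> eqI (edge_ideal Z U) (vprime (~: Z)).
Proof.
move=> /indepP iU x; split; move: x.
  apply: edge_ideal_sub; first exact/prime_is_ideal/vprime_prime.
    by move=> w wZ; apply/vprimeX; rewrite in_setC negbK.
  by move=> a b aU bU ab; have := iU a b aU bU; rewrite ab.
apply: vprime_sub; first exact: is_ideal_edge.
by move=> i; rewrite in_setC negbK; apply: edge_idealX.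
Qed.

Lemma edge_ideal_xfree Z U v : v \notin Z -> v \notin U -> xfree v (edge_ideal Z U).
Proof.
move=> vZ vU; apply: xfree_gen => x [[w wZ ->]|[a [b [aU bU ab ->]]]].
  by rewrite expandX; case: eqP => // wv; rewrite wv (negbTE vZ) in wZ.
rewrite expandM !expandX; case: eqP => [av|_]; first by rewrite av (negbTE vU) in aU.
by case: eqP => [bv|_]; rewrite ?polyCM //; rewrite bv (negbTE vU) in bU.
Qed.

Lemma edge_ideal_nzd Z U v : v \notin Z -> v \notin U -> nzd (edge_ideal Z U) 'X_v.
Proof.
move=> vZ vU; rewrite -univX; apply: xfree_nzd; first exact: is_ideal_edge.
  exact: edge_ideal_xfree.
by rewrite polyX_eq0.
Qed.

Section Step.
Variables (Z U : {set 'I_N}) (v : 'I_N).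
Hypotheses (ZU : [disjoint Z & U]) (vU : v \in U).

Definition linkZ := Z :|: (U :&: nbhd e v).
Definition linkU := U :\: (v |: nbhd e v).
Local Notation L := (edge_ideal linkZ linkU).
Local Notation J := (edge_ideal Z (U :\ v)).
Local Notation I := (edge_ideal Z U).

Lemma vNZ : v \notin Z. Proof. by rewrite (disjointFl ZU vU). Qed.

Lemma del_sub_link : subI J L.
Proof.
apply: edge_ideal_sub; first exact: is_ideal_edge.
  by move=> w wZ; apply: edge_idealX; rewrite inE wZ.
move=> a b; rewrite !in_setD1 => /andP[av aU] /andP[bv bU] ab.
have [va|va] := boolP (e v a).
  apply: is_idealMr; first exact: is_ideal_edge.
  by apply: edge_idealX; rewrite !inE aU va orbT.
have [vb|vb] := boolP (e v b).
  apply: is_idealMl; first exact: is_ideal_edge.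
  by apply: edge_idealX; rewrite !inE bU vb orbT.
by apply: edge_idealXX => //; rewrite !inE negb_or ?av ?bv ?va ?vb ?aU ?bU.
Qed.

Lemma del_sub : subI J I.
Proof.
apply: edge_ideal_sub; first exact: is_ideal_edge.
  by move=> w wZ; apply: edge_idealX.
by move=> a b /setD1P[_ aU] /setD1P[_ bU]; apply: edge_idealXX.
Qed.

Lemma edge_ideal_split x : I x <-> exists l j, [/\ L l, J j & x = l * 'X_v + j].
Proof.
have iL := is_ideal_edge linkZ linkU; have iJ := is_ideal_edge Z (U :\ v).
have iI := is_ideal_edge Z U.
split; move: x; last first.
  move=> _ [l [j [Ll /del_sub Ij ->]]]; apply: is_idealD => //.
  move: l Ll; apply: edge_ideal_sub.
  - split; first by rewrite mul0r; apply: is_ideal0.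
    split; first by move=> x y hx hy; rewrite mulrDl; apply: is_idealD.
    by move=> a x hx; rewrite -mulrA; apply: is_idealMl.
  - move=> w; rewrite !inE => /orP[wZ|/andP[wU vw]].
      by apply: is_idealMr => //; apply: edge_idealX.
    by apply: edge_idealXX; rewrite // e_sym.
  - move=> a b /setDP[aU _] /setDP[bU _] ab; apply: is_idealMr => //.
    exact: edge_idealXX.
apply: edge_ideal_sub.
- split; first by exists 0, 0; rewrite mul0r addr0; split=> //; apply: is_ideal0.
  split.
    move=> _ _ [l [j [Ll Jj ->]]] [l' [j' [Ll' Jj' ->]]].
    exists (l + l'), (j + j'); split; [exact: is_idealD|exact: is_idealD|].
    by rewrite mulrDl addrACA.
  move=> c _ [l [j [Ll Jj ->]]]; exists (c * l), (c * j).
  by split; [exact: is_idealMl|exact: is_idealMl|rewrite mulrDr mulrA].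
- move=> w wZ; exists 0, 'X_w; split; [exact: is_ideal0|exact: edge_idealX|].
  by rewrite mul0r add0r.
move=> a b aU bU ab; have [av|av] := eqVneq a v.
  exists 'X_b, 0; split; [|exact: is_ideal0|by rewrite av addr0 mulrC].
  by apply: edge_idealX; rewrite !inE bU -av ab orbT.
have [bv|bv] := eqVneq b v.
  exists 'X_a, 0; split; [|exact: is_ideal0|by rewrite bv addr0].
  by apply: edge_idealX; rewrite !inE aU -bv e_sym ab orbT.
exists 0, ('X_a * 'X_b); split; [exact: is_ideal0| |by rewrite mul0r add0r].
by apply: edge_idealXX => //; rewrite in_setD1 ?av ?bv.
Qed.

Lemma del_nzd : nzd J 'X_v.
Proof. by apply: edge_ideal_nzd; [exact: vNZ|rewrite setD11]. Qed.

(** By the splitting, [(h - l) * 'X_v] lies in the deletion ideal, modulo which ['X_v] is a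
    nonzerodivisor; and the deletion ideal is contained in that of the link. *)
Lemma edge_ideal_colon h : I (h * 'X_v) <-> L h.
Proof.
split; last first.
  move=> Lh; apply/edge_ideal_split; exists h, 0; rewrite addr0; split=> //.
  exact: (is_ideal0 (is_ideal_edge _ _)).
move/edge_ideal_split => [l [j [Ll Jj eh]]].
have : L (h - l).
  by apply/del_sub_link/del_nzd; rewrite mulrBl eh addrC addKr.
move=> hl; rewrite -(subrK l h); apply: is_idealD => //; exact: is_ideal_edge.
Qed.

Lemma edge_ideal_add_var : eqI (addgen I 'X_v) (edge_ideal (v |: Z) (U :\ v)).
Proof.
have i1 := is_ideal_addgen 'X_v (is_ideal_edge Z U).
have i2 := is_ideal_edge (v |: Z) (U :\ v).
move=> x; split; move: x.
  apply: addgen_sub => //; last by apply: edge_idealX; rewrite setU11.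
  apply: edge_ideal_sub => //.
    by move=> w wZ; apply: edge_idealX; rewrite inE wZ orbT.
  move=> a b aU bU ab; have [av|av] := eqVneq a v.
    by apply: is_idealMr => //; apply: edge_idealX; rewrite av setU11.
  have [bv|bv] := eqVneq b v.
    by apply: is_idealMl => //; apply: edge_idealX; rewrite bv setU11.
  by apply: edge_idealXX => //; rewrite in_setD1 ?av ?bv.
apply: edge_ideal_sub => //.
  move=> w; rewrite in_setU1 => /orP[/eqP ->|wZ].
    by apply: addgen_gen; apply: is_ideal_edge.
  by apply: addgen_l; apply: edge_idealX.
by move=> a b /setD1P[_ aU] /setD1P[_ bU] ab; apply: addgen_l; apply: edge_idealXX.
Qed.

Lemma edge_ideal_link_sum : eqI I (plusI (mulI 'X_v L) J).
Proof.
move=> x; split.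
  move/edge_ideal_split => [l [j [Ll Jj ->]]].
  apply: is_idealD; first exact: is_ideal_gen.
    apply: mem_ideal_gen; left; apply: mem_ideal_gen; exists l; split=> //.
    by rewrite mulrC.
  by apply: mem_ideal_gen; right.
move: x; apply: ideal_gen_sub; first exact: is_ideal_edge.
move=> x [|Jx]; last exact: del_sub.
apply: ideal_gen_sub; first exact: is_ideal_edge.
by move=> _ [l [Ll ->]]; rewrite mulrC; apply/edge_ideal_colon.
Qed.

Lemma disjoint_link : [disjoint linkZ & linkU].
Proof.
rewrite disjoint_subset; apply/subsetP => w; rewrite !inE negb_and negbK.
case/orP => [wZ|/andP[_ ->]]; last by rewrite orbT.
by rewrite (disjointFr ZU wZ) orbT.
Qed.

Lemma disjoint_del : [disjoint Z & U :\ v].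
Proof. exact: disjointWr (subsetDl _ _) ZU. Qed.

Lemma disjoint_add_var : [disjoint v |: Z & U :\ v].
Proof.
rewrite disjoint_subset; apply/subsetP => w; rewrite !inE.
by case/orP => [->//|wZ]; rewrite (disjointFr ZU wZ) andbF.
Qed.

(** In the deletion [v] becomes free and the independence number stays, so the height drops by one,
    as a basic double link requires. In the link [v] also becomes free, but the independence number
    drops, so the height is unchanged. *)
Lemma free_del : #|~: (Z :|: U :\ v)| = #|~: (Z :|: U)|.+1.
Proof.
rewrite (cardsD1 v) !inE eqxx (negbTE vNZ) /= add1n; congr _.+1; apply: eq_card => w.
rewrite !inE; case: eqP => [->|//]; by rewrite vU orbT.
Qed.

Lemma free_link : #|~: (linkZ :|: linkU)| = #|~: (Z :|: U)|.+1.
Proof.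
rewrite (cardsD1 v) !inE eqxx (negbTE vNZ) vU e_irr /= add1n; congr _.+1.
apply: eq_card => w; rewrite !inE; case: eqP => [->|_] /=; first by rewrite vU orbT.
by case: (w \in Z); case: (w \in U); case: (e v w).
Qed.

Lemma free_add_var : ~: (v |: Z :|: U :\ v) = ~: (Z :|: U).
Proof.
apply/setP => w; rewrite !inE; case: eqP => [->|//] /=.
by rewrite vU orbT.
Qed.

End Step.

(** The colon by ['X_v] and the sum with ['X_v] have the dimension of the ideal itself, so one and
    the same sequence serves throughout [wreg_colon]. *)
Lemma wreg_edge_ideal U d (q : 'I_N -> {poly K}) : (forall i, q i != 0) ->
  vdec_graph e U d -> forall Z, [disjoint Z & U] ->
  wreg (edge_ideal Z U) (elem_syms q (#|~: (Z :|: U)| + d)).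
Proof.
move=> q0; elim=> {U d} [U iU|U v d vU _ IHD _ IHL] Z ZU.
  have -> : (#|~: (Z :|: U)| + #|U| = #|~: Z|)%N.
    rewrite -(cardsID U (~: Z)) addnC setDE -setCU; congr (_ + _)%N.
    by congr #|pred_of_set _|; apply/esym/setIidPr; rewrite -disjoints_subset disjoint_sym.
  apply: (@wreg_ext _ (vprime (~: Z))); last exact: wreg_vprime.
  by move=> x; apply: iff_sym; apply: edge_ideal_indep.
apply: (@wreg_colon _ _ (edge_ideal (linkZ Z U v) (linkU U v)) 'X_v).
- exact: is_ideal_edge.
- exact: is_ideal_edge.
- exact: edge_ideal_colon.
- have := IHL _ (disjoint_link v ZU).
  by rewrite -/(linkU U v) (free_link ZU vU) addSnnS.
apply: (@wreg_ext _ (edge_ideal (v |: Z) (U :\ v))).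
  by move=> x; apply: iff_sym; apply: edge_ideal_add_var.
by have := IHD _ (disjoint_add_var v ZU); rewrite free_add_var.
Qed.

(** The variables outside a prime over the ideal avoid [Z] and are independent inside [U], which
    bounds their number; a largest independent set together with the free variables attains the
    bound. *)
Lemma edge_ideal_dim U d Z : vdec_graph e U d -> [disjoint Z & U] ->
  has_dim (edge_ideal Z U) (#|~: (Z :|: U)| + d).
Proof.
move=> /(sg_max_indep e_sym e_irr)[[S SU [iS cS]] mS] ZU; split.
  exists (S :|: ~: (Z :|: U)).
    rewrite -cS addnC -cardsUI [_ :&: _](_ : _ = set0) ?cards0 ?addn0 //.
    apply/eqP; rewrite setI_eq0 disjoints_subset setCK.
    by apply: subset_trans SU (subsetUr _ _).
  apply: edge_ideal_sub; first exact/prime_is_ideal/vprime_prime.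
    move=> w wZ; apply/vprimeX; rewrite !inE wZ /= orbF.
    by apply/negP => /(subsetP SU); rewrite (disjointFr ZU wZ).
  move=> a b aU bU ab; have iP := prime_is_ideal (@vprime_prime K N (S :|: ~: (Z :|: U))).
  have [aS|aS] := boolP (a \in S); last first.
    by apply: is_idealMr => //; apply/vprimeX; rewrite !inE negb_or aS aU orbT.
  have [bS|bS] := boolP (b \in S); last first.
    by apply: is_idealMl => //; apply/vprimeX; rewrite !inE negb_or bS bU orbT.
  by have /indepP/(_ a b aS bS) := iS; rewrite ab.
move=> P pP IP; have iP := prime_is_ideal pP.
pose F := [set i : 'I_N | ~~ pbool (P 'X_i)].
have FP i : (i \in F) = false -> P 'X_i.
  by rewrite inE /pbool; case: excluded_middle_informative.
have FNP i : i \in F -> ~ P 'X_i.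
  by rewrite inE /pbool; case: excluded_middle_informative.
exists F; last by apply: vprime_sub => // i /negbTE/FP.
have FZ w : w \in F -> w \notin Z.
  by move=> /FNP wF; apply/negP => wZ; apply: wF; apply: IP; apply: edge_idealX.
rewrite -(cardsID U F) addnC leq_add //.
  apply: subset_leq_card; apply/subsetP => w /setDP[/FZ wZ wU].
  by rewrite !inE negb_or wZ.
apply: mS; first exact: subsetIr.
apply/indepP => a b /setIP[aF aU] /setIP[bF bU]; apply/negP => ab.
have /(primeM pP)[|] : P ('X_a * 'X_b) by apply: IP; apply: edge_idealXX.
  exact: FNP.
exact: FNP.
Qed.

Lemma edge_ideal_CM U d Z : vdec_graph e U d -> [disjoint Z & U] ->
  CM_quot (edge_ideal Z U).
Proof.
move=> sU ZU; apply: has_dim_CM (edge_ideal_dim sU ZU) _; first exact: is_ideal_edge.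
by move=> q q0; apply: wreg_edge_ideal.
Qed.

Lemma edge_ideal_homog Z U : homog_ideal (edge_ideal Z U).
Proof.
exists (edge_gen Z U); split=> // x [[w _ ->]|[a [b [_ _ _ ->]]]].
  by exists 1%N => m; rewrite msuppX inE => /eqP ->; rewrite mdeg1.
by exists 2%N => m; rewrite -mpolyXD msuppX inE => /eqP ->; rewrite mdegD !mdeg1.
Qed.

Lemma edge_ideal_bdl Z U v d : [disjoint Z & U] -> v \in U ->
  vdec_graph e (U :\ v) d.+1 -> vdec_graph e (linkU U v) d ->
  basic_double_link (edge_ideal (linkZ Z U v) (linkU U v)) (edge_ideal Z U).
Proof.
move=> ZU vU sD sL; exists (edge_ideal Z (U :\ v)), 'X_v.
have dD := edge_ideal_dim sD (disjoint_del v ZU).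
have dL := edge_ideal_dim sL (disjoint_link v ZU).
split; first exact: edge_ideal_homog.
split; first exact: edge_ideal_homog.
split; first by exists 1%N => m; rewrite msuppX inE => /eqP ->; rewrite mdeg1.
split; first exact: del_sub_link.
split.
  have := has_dim_height dD; have := has_dim_height dL; have := has_dim_le dD.
  rewrite (free_del ZU vU) (free_link ZU vU); set c := #|_| => le hL hD.
  exists (N - (c.+1 + d.+1))%N; split=> //.
  by have <- : (N - (c.+1 + d) = (N - (c.+1 + d.+1)).+1)%N by lia.
split.
  move=> x; split; first by move=> h; apply: (del_nzd ZU vU); exact: h.
  by move=> h; apply: is_idealMr => //; apply: is_ideal_edge.
split; first exact: edge_ideal_CM sL (disjoint_link v ZU).
split; first exact: edge_ideal_CM sD (disjoint_del v ZU).
exact: edge_ideal_link_sum.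
Qed.

(** Only links are followed: the deletion enters each basic double link as the smaller ideal [J]. *)
Lemma edge_ideal_chain U d : vdec_graph e U d -> forall Z, [disjoint Z & U] ->
  exists (c : nat -> R -> Prop) (k : nat),
    [/\ var_ideal (c 0%N), forall t, (t < k)%N -> basic_double_link (c t) (c t.+1)
      & c k = edge_ideal Z U].
Proof.
elim=> {U d} [U iU|U v d vU sD _ sL IHL] Z ZU.
  exists (fun _ => edge_ideal Z U), 0%N; split=> //.
  exists (mem Z) => x; split; move: x.
    apply: edge_ideal_sub; first exact: is_ideal_gen.
      by move=> w wZ; apply: mem_ideal_gen; exists w.
    by move=> a b aU bU ab; have /indepP/(_ a b aU bU) := iU; rewrite ab.
  apply: ideal_gen_sub; first exact: is_ideal_edge.
  by move=> _ [i [iZ ->]]; apply: edge_idealX.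
have [c [k [c0 hc ck]]] := IHL _ (disjoint_link v ZU).
exists (fun t => if (t <= k)%N then c t else edge_ideal Z U), k.+1; split=> //.
  move=> t; rewrite ltnS => tk; rewrite tk; case: ifP => tk'; first exact: hc.
  have -> : t = k by lia.
  by rewrite ck; apply: edge_ideal_bdl sD sL.
by rewrite ltnn.
Qed.

Lemma SR_edge_ideal (I : R -> Prop) :
  eqI I (edge_ideal set0 setT) -> SR_complex I = indep_complex e setT.
Proof.
move=> eI; apply/setP => F; rewrite !inE subsetT /=.
apply/idP/indepP => [|iF].
  rewrite /pbool; case: excluded_middle_informative => // nI _ a b aF bF.
  apply/negP => ab; apply: nI; apply/eI.
  have ba : b != a by apply: contraTneq ab => ->; rewrite e_irr.
  rewrite (bigD1 a) //= (bigD1 b) /=; last by rewrite bF.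
  rewrite mulrA; apply: is_idealMr; first exact: is_ideal_edge.
  by apply: edge_idealXX.
rewrite /pbool; case: excluded_middle_informative => // h; exfalso; apply: h.
move=> /eI hI; have : vprime F (\prod_(i in F) 'X_i : R).
  move: hI; apply: edge_ideal_sub; first exact/prime_is_ideal/vprime_prime.
    by move=> w; rewrite in_set0.
  have iP := prime_is_ideal (@vprime_prime K N F).
  move=> a b _ _ ab; have [aF|aF] := boolP (a \in F).
    have [bF|bF] := boolP (b \in F); first by have := iF a b aF bF; rewrite ab.
    by apply: is_idealMl => //; apply/vprimeX.
  by apply: is_idealMr => //; apply/vprimeX.
suff : ~ vprime F (\prod_(i in F) 'X_i : R) by [].
elim/big_ind: _ => [|x y hx hy|i iF'].
- exact/prime_not1/vprime_prime.
- by case/(primeM (@vprime_prime K N F)).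
- by move/vprimeX; rewrite iF'.
Qed.

End EdgeIdeals.

(** * Vertex decomposability of ladder graphs *)

Section Ladders.
Local Open Scope nat_scope.
Variables (V : finType) (e : rel V) (r c : V -> nat).
Hypotheses (e_sym : ssrbool.symmetric e) (e_irr : irreflexive e).
Hypothesis rc_inj : forall u w, r u = r w -> c u = c w -> u = w.
Implicit Types (A U : {set V}) (u v w x : V).

Definition has_cell A i j := [exists x in A, (r x == i) && (c x == j)].

Lemma has_cellP A i j : reflect (exists2 x, x \in A & r x = i /\ c x = j) (has_cell A i j).
Proof.
apply: (iffP exists_inP) => -[x xA]; first by case/andP=> /eqP ? /eqP ?; exists x.
by case=> <- <-; exists x; rewrite ?eqxx.
Qed.

(* [A] is the array part of the graph on [U]: its rows are the nested column sets
   R_1 >= ... >= R_n, with R_i in [i, oo), and u = (i, j), w = (k, l) with i < k are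
   adjacent iff j < l and j lies in R_k or j < k. The vertices outside [A] are
   isolated. *)
Record ladder n A U : Prop := Ladder {
  ladder_sub : A \subset U;
  ladder_row : forall v, v \in A -> (0 < r v <= n)%N;
  ladder_col : forall v, v \in A -> (r v <= c v)%N;
  ladder_nest : forall v, v \in A -> forall i, (0 < i <= r v)%N -> has_cell A i (c v);
  ladder_last : exists2 v, v \in A & r v = n;
  ladder_edge : forall u w, u \in A -> w \in A -> (r u < r w)%N ->
    e u w = (c u < c w)%N && ((c u < r w)%N || has_cell A (r w) (c u));
  ladder_same : forall u w, u \in A -> w \in A -> r u = r w -> ~~ e u w;
  ladder_iso : forall u w, u \in U -> u \notin A -> w \in U -> ~~ e u w;
  ladder_up : forall v j, v \in A -> r v = 1%N -> (c v <= j < n)%N -> has_cell A 1 j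
}.

(** The array contributes [#|top_row n A| + n.-1] to the independence number. For a full rectangle
    with columns from [n] on this is columns plus rows minus one, the length of a lattice path. *)
Definition top_row n A := [set v in A | (r v == 1%N) && (n <= c v)%N].

Lemma ladder_single_row A U : ladder 1 A U ->
  vdec_graph e U (#|U :\: A| + #|top_row 1 A|).
Proof.
move=> L; have r1 v : v \in A -> r v = 1%N by move=> /(ladder_row L); lia.
have -> : (#|U :\: A| + #|top_row 1 A| = #|U|)%N.
  have -> : top_row 1 A = A.
    apply/setP => v; rewrite inE; case: (boolP (v \in A)) => //= vA.
    by rewrite (r1 v vA) eqxx /= -{1}(r1 v vA) (ladder_col L).
  by rewrite -(cardsID A U) (setIidPr (ladder_sub L)) addnC.
apply: sg_indep; apply/indepP => a b aU bU.
have [aA|aA] := boolP (a \in A); last exact: (ladder_iso L).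
have [bA|bA] := boolP (b \in A); last by rewrite e_sym; apply: (ladder_iso L).
by apply: (ladder_same L) => //; rewrite !r1.
Qed.

Section Corner.
Variables (n : nat) (A U : {set V}) (v : V).
Hypotheses (L : ladder n.+2 A U) (vA : v \in A) (rv : r v = n.+2).
Hypothesis v_max : forall x, x \in A -> r x = n.+2 -> (c x <= c v)%N.

Let row_lt x : x \in A -> r x != n.+2 -> (0 < r x < n.+2)%N.
Proof. by move=> /(ladder_row L); lia. Qed.

Let v_col : (n.+2 <= c v)%N. Proof. by rewrite -rv (ladder_col L). Qed.

Let vU : v \in U. Proof. exact: (subsetP (ladder_sub L)). Qed.

Let edge_v w : w \in A -> r w != n.+2 ->
  e v w = (c w < c v)%N && ((c w < n.+2)%N || has_cell A n.+2 (c w)).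
Proof.
move=> wA rw; have := row_lt wA rw => /andP[_ lt].
by rewrite e_sym (ladder_edge L wA vA) rv.
Qed.

Let cell_D1 i j : i != n.+2 -> has_cell (A :\ v) i j = has_cell A i j.
Proof.
move=> i_n; apply/has_cellP/has_cellP => -[x].
  by move=> /setD1P[_ xA] h; exists x.
move=> xA [rx cx]; exists x => //; rewrite in_setD1 xA andbT.
by apply: contraNneq i_n => xv; rewrite -rx xv rv.
Qed.

Let last_below : exists2 w, w \in A & r w = n.+1 /\ c w = c v.
Proof. by apply/has_cellP/(ladder_nest L vA); rewrite rv; lia. Qed.

Section SingleLast.
Hypothesis v_single : forall x, x \in A -> r x = n.+2 -> x = v.

Let row_D1 w : w \in A :\ v -> (0 < r w < n.+2)%N.
Proof.
move=> /setD1P[wv wA]; apply: row_lt => //.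
by apply: contraNneq wv => /(v_single wA)/eqP.
Qed.

Lemma ladder_drop_row U' : A :\ v \subset U' -> U' \subset U ->
  (forall w, v \in U' -> w \in U' -> ~~ e v w) -> ladder n.+1 (A :\ v) U'.
Proof.
move=> sub /subsetP U'U hv; split=> //.
- by move=> w /setD1P[_]; apply: (ladder_col L).
- move=> w wA i iw; have := row_D1 wA => rw; rewrite cell_D1; last by lia.
  by move/setD1P: wA => [_ /(ladder_nest L)]; apply.
- have [w wA [rw _]] := last_below; exists w => //; rewrite in_setD1 wA andbT.
  by apply: contra_eqN rw => /eqP ->; rewrite rv; lia.
- move=> u w uA wA lt; have rw := row_D1 wA; rewrite cell_D1; last by lia.
  by move/setD1P: uA => [_ uA]; move/setD1P: wA => [_ wA]; apply: (ladder_edge L).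
- by move=> u w /setD1P[_ uA] /setD1P[_ wA]; apply: (ladder_same L).
- move=> u w uU uA wU; have [uv|uv] := eqVneq u v; first by rewrite uv in uU *; apply: hv.
  apply: (ladder_iso L); [exact: U'U| |exact: U'U].
  by apply: contra uA => uA; rewrite in_setD1 uv.
- move=> w j /setD1P[_ wA] rw cw; rewrite cell_D1 //.
  by apply: (ladder_up L wA rw); lia.
Qed.

(** A neighbour of [v] would need a cell of the last row in its column, strictly left of [v]. So [v]
    is isolated: one row is lost and one isolated vertex gained. *)
Lemma ladder_isolated_corner : (forall w, w \in A -> (n.+2 <= c w)%N) ->
  ladder n.+1 (A :\ v) U.
Proof.
move=> hc; apply: ladder_drop_row => //.
  exact: subset_trans (subsetDl _ _) (ladder_sub L).
move=> w _ wU; have [wA|wA] := boolP (w \in A); last first.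
  by rewrite e_sym; apply: (ladder_iso L).
have [->|wv] := eqVneq w v; first by rewrite e_irr.
have rw : r w != n.+2 by apply: contraNneq wv => /(v_single wA)/eqP.
rewrite edge_v // [(c w < n.+2)%N]ltnNge (hc w wA) /=; apply/negP => /andP[lt /has_cellP[x xA [rx cx]]].
by move: lt; rewrite -cx (v_single xA rx) ltnn.
Qed.

Lemma top_row_isolated_corner : (forall w, w \in A -> (n.+2 <= c w)%N) ->
  top_row n.+1 (A :\ v) = top_row n.+2 A.
Proof.
move=> hc; apply/setP => w; rewrite !inE; have [->|wv] /= := eqVneq w v.
  by rewrite rv andbF.
have [wA|//] := boolP (w \in A); rewrite (hc w wA) ltnW ?(hc w wA) //.
Qed.

Lemma ladder_drop_corner : ladder n.+1 (A :\ v) (U :\ v).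
Proof.
apply: ladder_drop_row; [exact: setSD (ladder_sub L)|exact: subsetDl|].
by move=> w; rewrite setD11.
Qed.

(** The lost row is balanced by the cell (1, n + 1), which counts under the lowered threshold; it
    exists by [ladder_up], because some column is below [n.+2]. *)
Lemma top_row_drop_corner w0 : w0 \in A -> (c w0 < n.+2)%N ->
  #|top_row n.+1 (A :\ v)| = #|top_row n.+2 A|.+1.
Proof.
move=> w0A cw0; have /has_cellP[x xA [rx cx]] : has_cell A 1 (c w0).
  by apply: (ladder_nest L w0A); move: (ladder_row L w0A); lia.
have /has_cellP[y yA [ry cy]] : has_cell A 1 n.+1.
  by apply: (ladder_up L xA rx); lia.
rewrite (cardsD1 y) !inE yA ry cy leqnn eqxx /= andbT.
have -> : y != v by apply: contra_eq_neq ry => ->; rewrite rv.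
rewrite add1n; congr _.+1; apply: eq_card => w; rewrite !inE.
have [->|wy] /= := eqVneq w y; first by rewrite cy ltnn !andbF.
have [->|wv] /= := eqVneq w v; first by rewrite rv andbF.
case: (boolP (w \in A)) => //= wA; case: eqP => //= rw.
rewrite leq_eqVlt; case: eqP => //= cw; case/eqP: wy.
by apply: rc_inj; rewrite ?rw ?ry ?cy.
Qed.

End SingleLast.

Lemma ladder_delete w1 : w1 \in A -> r w1 = n.+2 -> w1 != v ->
  ladder n.+2 (A :\ v) (U :\ v).
Proof.
move=> w1A rw1 w1v; split.
- exact: setSD (ladder_sub L).
- by move=> w /setD1P[_]; apply: (ladder_row L).
- by move=> w /setD1P[_]; apply: (ladder_col L).
- move=> w /setD1P[wv wA] i iw; have /has_cellP[x xA [rx cx]] := ladder_nest L wA iw.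
  apply/has_cellP; exists x => //; rewrite in_setD1 xA andbT.
  apply: contraNneq wv => xv; have := ladder_row L wA; rewrite xv in rx cx.
  by move=> rw; apply/eqP/rc_inj => //; lia.
- by exists w1 => //; rewrite in_setD1 w1v.
- move=> u w /setD1P[uv uA] /setD1P[wv wA] lt; rewrite (ladder_edge L) //.
  have [cuw|//] := ltnP (c u) (c w); congr (_ || _).
  apply/has_cellP/has_cellP => -[x xA [rx cx]]; exists x => //.
    (* The removed cell cannot have been the witness in column [c u], because [c u < c w <= c v]. *)
    rewrite in_setD1 xA andbT; apply/eqP => xv.
    have rw : r w = n.+2 by rewrite -rx xv rv.
    by move: (v_max wA rw) cuw; rewrite -cx xv; lia.
  by case/setD1P: xA.
- by move=> u w /setD1P[_ uA] /setD1P[_ wA]; apply: (ladder_same L).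
- move=> u w /setD1P[uv uU]; rewrite in_setD1 uv /= => uA /setD1P[_ wU].
  exact: (ladder_iso L).
- move=> w j /setD1P[_ wA] rw cw; rewrite cell_D1 //; exact: (ladder_up L wA rw).
Qed.

Lemma top_row_delete : top_row n.+2 (A :\ v) = top_row n.+2 A.
Proof.
by apply/setP => w; rewrite !inE; have [->|] := eqVneq w v; rewrite //= rv andbF.
Qed.

(** The link loses the columns below [n.+2] and those of the other cells of the last row. These
    other cells are not adjacent to [v]; they survive as isolated vertices. *)
Definition link_array := [set w in A | [&& (r w < n.+2)%N, (n.+2 <= c w)%N &
  (c w == c v) || ~~ has_cell A n.+2 (c w)]].

Let U' := U :\: (v |: nbhd e v).

Let link_array_row w : w \in A -> r w != n.+2 -> (w \in U') = (w \in link_array).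
Proof.
move=> wA rw; have lt := row_lt wA rw; have wU := subsetP (ladder_sub L) _ wA.
have wv : w != v by apply: contraNneq rw => ->; rewrite rv.
rewrite !inE negb_or wv wU wA andbT edge_v //=.
have -> /= : (r w < n.+2)%N by lia.
have [lt1|gt|eq1] := ltngtP (c w) (c v) => /=.
- by rewrite negb_or -leqNgt.
- have -> : (n.+2 <= c w)%N by apply: leq_trans v_col (ltnW gt).
  symmetry; apply/has_cellP => -[x xA [rx cx]]; have := v_max xA rx; lia.
- by rewrite eq1 v_col.
Qed.

Let link_arrayS w : w \in link_array -> w \in A /\ r w != n.+2.
Proof. by rewrite inE => /andP[-> /and3P[h _ _]]; split=> //; lia. Qed.

Let link_outside : U' :\: link_array = (U :\: A) :|: [set x in A | (r x == n.+2) && (x != v)].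
Proof.
apply/setP => w; rewrite in_setD in_setU in_setD inE.
have [wA|wA] /= := boolP (w \in A); last first.
  have wv : w != v by apply: contraNneq wA => ->.
  rewrite !inE (negbTE wv) (negbTE wA) /= orbF.
  case: (boolP (w \in U)) => wU; rewrite ?andbF //= andbT.
  by rewrite e_sym (ladder_iso L).
have [rw|rw] /= := eqVneq (r w) n.+2; last by rewrite link_array_row // andNb.
rewrite !inE rw ltnn andbF /= (subsetP (ladder_sub L) _ wA) andbT negb_or.
have [->|wv] //= := eqVneq w v.
by rewrite (ladder_same L) // rw rv.
Qed.

Lemma ladder_link : ladder n.+1 link_array U'.
Proof.
have inA w i j : has_cell A i j -> (i < n.+2)%N -> w \in link_array -> c w = j ->
  has_cell link_array i j.
  move=> /has_cellP[x xA [rx cx]] ni; rewrite inE => /andP[_ /and3P[_ h1 h2]] cw.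
  by apply/has_cellP; exists x => //; rewrite inE xA rx cx ni -cw h1.
split.
- by apply/subsetP => w wL; have [wA rw] := link_arrayS wL; rewrite link_array_row.
- by move=> w /link_arrayS[wA /(row_lt wA)]; lia.
- by move=> w /link_arrayS[wA _]; apply: (ladder_col L).
- move=> w wL i iw; have [wA rw] := link_arrayS wL; have := row_lt wA rw => lt.
  by apply: (inA w) => //; [exact: (ladder_nest L)|lia].
- have [w wA [rw cw]] := last_below; exists w => //.
  by rewrite inE wA rw cw ltnSn v_col eqxx.
- move=> u w uL wL lt; have [uA ru] := link_arrayS uL; have [wA rw] := link_arrayS wL.
  rewrite (ladder_edge L) //; congr (_ && (_ || _)).
  apply/idP/idP => [h|/has_cellP[x /link_arrayS[xA _] h]]; last by apply/has_cellP; exists x.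
  by apply: (inA u) => //; have := row_lt wA rw; lia.
- by move=> u w /link_arrayS[uA _] /link_arrayS[wA _]; apply: (ladder_same L).
- move=> u w uU uL wU'; have : u \in U' :\: link_array by rewrite in_setD uL.
  have wU : w \in U by case/setDP: wU'.
  rewrite link_outside in_setU in_setD inE => /orP[/andP[uA]|/and3P[uA /eqP ru uv]].
    by move=> uU0; apply: (ladder_iso L).
  have [wA|wA] := boolP (w \in A); last first.
    by rewrite e_sym; apply: (ladder_iso L) => //; apply: (subsetP (ladder_sub L)).
  have [rw|rw] := eqVneq (r w) n.+2; first by apply: (ladder_same L); rewrite ?ru ?rw.
  move: wU'; rewrite link_array_row // inE => /andP[_ /and3P[_ cw1 cw2]].
  have lt := row_lt wA rw; rewrite e_sym (ladder_edge L) ?ru //; last by lia.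
  rewrite [(c w < n.+2)%N]ltnNge cw1 /=; case/orP: cw2 => [/eqP ->|/negbTE ->]; last by rewrite andbF.
  by rewrite ltnNge v_max.
- by move=> w j; rewrite inE => /andP[_ /and3P[_ h _]] _; lia.
Qed.

(** Each newly isolated cell of the last row is traded for the first-row cell of its column, which
    leaves the top row; [f] is this bijection. Lowering the threshold adds nothing, since the
    columns of the link start at [n.+2]. *)
Lemma card_ladder_link :
  (#|U' :\: link_array| + #|top_row n.+1 link_array| = #|U :\: A| + #|top_row n.+2 A|)%N.
Proof.
pose X := [set x in A | (r x == n.+2) && (x != v)].
rewrite link_outside -/X cardsU [_ :&: _](_ : _ = set0) ?cards0 ?subn0; last first.
  by apply/setP => w; rewrite !inE; case: (w \in A); rewrite //= andbF.
rewrite -addnA; congr (_ + _)%N.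
pose Y := [set w in A | [&& r w == 1%N, c w != c v & has_cell A n.+2 (c w)]].
pose f x := odflt x [pick w in A | (r w == 1%N) && (c w == c x)].
have fP x : x \in A -> [/\ f x \in A, r (f x) = 1%N & c (f x) = c x].
  move=> xA; rewrite /f; case: pickP => [w /and3P[wA /eqP rw /eqP cw]|no] //=.
  have /has_cellP[w wA [rw cw]] : has_cell A 1 (c x).
    by apply: (ladder_nest L xA); have := ladder_row L xA; lia.
  by have := no w; rewrite wA rw cw !eqxx.
have <- : #|Y| = #|X|.
  have -> : Y = f @: X.
    apply/setP => w; rewrite inE; apply/idP/imsetP.
      move=> /and4P[wA /eqP rw cw /has_cellP[x xA [rx cx]]]; exists x.
        by rewrite inE xA rx eqxx /=; apply: contraNneq cw => xv; rewrite -cx xv.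
      by have [fA rf cf] := fP x xA; apply: rc_inj; rewrite ?rf ?cf ?cx.
    move=> [x]; rewrite inE => /and3P[xA /eqP rx xv] ->; have [fA rf cf] := fP x xA.
    rewrite fA rf cf eqxx /=; apply/andP; split.
      by apply: contraNneq xv => cx; apply/eqP/rc_inj; rewrite ?rx ?rv.
    by apply/has_cellP; exists x.
  rewrite card_in_imset // => x y; rewrite !inE => /and3P[xA /eqP rx _] /and3P[yA /eqP ry _] fxy.
  by have [_ _ cx] := fP x xA; have [_ _ cy] := fP y yA; apply: rc_inj; rewrite ?rx ?ry -?cx -?cy ?fxy.
rewrite -cardsUI [_ :&: _](_ : _ = set0) ?cards0 ?addn0; last first.
  apply/setP => w; rewrite !inE; case: (w \in A); rewrite //=.
  by case: (c w == c v); case: (has_cell _ _ _); rewrite /= ?andbF.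
apply: eq_card => w; rewrite !inE; case: (boolP (w \in A)) => //= wA.
case: eqP => //= [rw|]; last by rewrite andbF.
rewrite rw /=; have [cw|cw] := boolP (has_cell A n.+2 (c w)).
  have h : (n.+1 < c w)%N by have /has_cellP[x xA [<- <-]] := cw; exact: (ladder_col L).
  by rewrite h (ltnW h); case: (c w == c v).
by rewrite andbF orbT /=; have [h|//] := ltnP n.+1 (c w); rewrite ltnW.
Qed.

End Corner.

Theorem ladder_vdec n A U : ladder n A U ->
  vdec_graph e U (#|U :\: A| + #|top_row n A| + n.-1).
Proof.
have [k] := ubnP #|A|; elim: k n A U => // k IH n A U lt L.
have [v0 v0A rv0] := ladder_last L.
case: n L rv0 => [|[|n]] L rv0.
- by have := ladder_row L v0A; rewrite rv0.
- by rewrite addn0; apply: ladder_single_row.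
pose X := [set x in A | r x == n.+2].
have v0X : v0 \in X by rewrite inE v0A rv0 eqxx.
pose v := [arg max_(x > v0 in X) c x].
have [vX vmax] : v \in X /\ forall x, x \in X -> (c x <= c v)%N.
  by rewrite /v; case: arg_maxnP.
move: vX; rewrite inE => /andP[vA /eqP rv].
have v_max x : x \in A -> r x = n.+2 -> (c x <= c v)%N.
  by move=> xA rx; apply: vmax; rewrite inE xA rx eqxx.
have vU : v \in U by apply: (subsetP (ladder_sub L)).
have cA : #|A| = #|A :\ v|.+1 by rewrite (cardsD1 v) vA.
have ltD : (#|A :\ v| < k)%N by lia.
have cUD : U :\ v :\: (A :\ v) = U :\: A.
  by apply/setP => w; rewrite !inE; case: eqP => [->|_] //=; rewrite vA.
have sLink : vdec_graph e (U :\: (v |: nbhd e v)) (#|U :\: A| + #|top_row n.+2 A| + n).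
  have ll := ladder_link L vA rv v_max.
  rewrite -(card_ladder_link L vA rv v_max); apply: IH ll.
  apply: leq_ltn_trans ltD; apply: subset_leq_card; apply/subsetP => w.
  rewrite !inE => /andP[wA /and3P[rw _ _]]; rewrite wA andbT.
  by apply: contraTneq rw => ->; rewrite rv ltnn.
have [/exists_inP[w1 w1A /andP[/eqP rw1 w1v]]|single] :=
  boolP [exists x in A, (r x == n.+2) && (x != v)].
  rewrite /= addnS; apply: (sg_step vU) => //.
  have := IH _ _ _ ltD (ladder_delete L vA rv v_max w1A rw1 w1v).
  by rewrite cUD (top_row_delete A rv) /= addnS.
have v_single x : x \in A -> r x = n.+2 -> x = v.
  move=> xA rx; apply/eqP; rewrite -[_ == _]negbK; apply: contra single => xv.
  by apply/exists_inP; exists x => //; rewrite rx eqxx.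
have [/exists_inP[w0 w0A cw0]|deep] := boolP [exists x in A, (c x < n.+2)%N].
  rewrite /= addnS; apply: (sg_step vU) => //.
  have := IH _ _ _ ltD (ladder_drop_corner L vA rv v_single).
  by rewrite cUD (top_row_drop_corner L vA rv w0A cw0) /= addnS addSn.
have hc w : w \in A -> (n.+2 <= c w)%N.
  by move=> wA; rewrite leqNgt; apply: contra deep => h; apply/exists_inP; exists w.
(* Here no vertex leaves the graph: only the array shrinks, and [v] moves to the isolated
   vertices. *)
have := IH _ _ _ ltD (ladder_isolated_corner L vA rv v_single hc).
rewrite (top_row_isolated_corner rv hc) /=.
have -> : #|U :\: (A :\ v)| = #|U :\: A|.+1.
  rewrite (cardsD1 v) !inE eqxx vU /= add1n; congr _.+1; apply: eq_card => w.
  by rewrite !inE; case: eqP => [->|_] //=; rewrite vA.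
by rewrite !addSn addnS.
Qed.

End Ladders.

(** * Initial ideals of ladders *)

Import Order.TTheory Num.Theory.

Lemma steps_homo (R : rel nat) (f : nat -> nat) n :
  reflexive R -> transitive R -> (forall i, (0 < i < n)%N -> R (f i) (f i.+1)) ->
  forall i k, (0 < i <= k)%N -> (k <= n)%N -> R (f i) (f k).
Proof.
move=> Rr Rt step i k /andP[i0]; elim: k => [|k IH]; first by rewrite leqn0 => /eqP ->.
rewrite leq_eqVlt => /orP[/eqP <- _|]; first exact: Rr.
rewrite ltnS => ik kn; apply: Rt (IH ik (ltnW kn)) (step _ _); lia.
Qed.

Section LadderIdeal.
Variables (K : fieldType) (N : nat) (r c : 'I_N -> nat).
Variables (n : nat) (lam mu : nat -> nat).
Implicit Types (u v w x y : 'I_N) (m : 'X_{1..N}).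
Local Notation R := {mpoly K[N]}.

Hypothesis n_gt0 : (0 < n)%N.
Hypothesis cell : forall v, (0 < r v <= n)%N && (mu (r v) < c v <= lam (r v))%N.
Hypothesis cell_surj : forall i j, (0 < i <= n)%N -> (mu i < j <= lam i)%N ->
  exists v, r v = i /\ c v = j.
Hypothesis cell_inj : forall u v, r u = r v -> c u = c v -> u = v.
Hypothesis lam_anti : forall i k, (0 < i <= k)%N -> (k <= n)%N -> (lam k <= lam i)%N.
Hypothesis mu_mono : forall i k, (0 < i <= k)%N -> (k <= n)%N -> (mu i <= mu k)%N.
Hypothesis mu_lam : (mu n < lam n)%N.
Hypothesis mu_diag : forall i, (0 < i <= n)%N -> (i.-1 <= mu i)%N.

Definition cell_gt u w := (r u < r w)%N || ((r u == r w) && (c u < c w)%N).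

(** The second alternative stems from minors of the symmetrized array that read [w] at its mirror
    position, in rows [r u < c w] and columns [c u < r w]. *)
Definition corner u w :=
  [&& (r u < r w)%N, (c u < c w)%N & (mu (r w) < c u)%N || (c u < r w)%N].

Definition corner_graph : rel 'I_N := fun u w => corner u w || corner w u.

Lemma corner_graph_sym : ssrbool.symmetric corner_graph.
Proof. by move=> u w; rewrite /corner_graph orbC. Qed.

Lemma corner_graph_irr : irreflexive corner_graph.
Proof. by move=> u; rewrite /corner_graph /corner ltnn. Qed.

Let row_le_col v : (r v <= c v)%N.
Proof. by have := cell v; case/andP => /mu_diag; lia. Qed.

Let n_le_lam : (n <= lam n)%N.
Proof. by have := @mu_diag n; rewrite n_gt0 leqnn => /(_ isT); lia. Qed.

Let mu_lt_lam i : (0 < i <= n)%N -> (mu i < lam i)%N.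
Proof.
by move=> i_n; have := mu_mono i_n (leqnn n); have := lam_anti i_n (leqnn n); lia.
Qed.

Lemma corner_ladder : ladder corner_graph r c n setT setT.
Proof.
have has i j : (0 < i <= n)%N -> (mu i < j <= lam i)%N -> has_cell r c setT i j.
  by move=> hi hj; apply/has_cellP; have [v [rv cv]] := cell_surj hi hj; exists v.
split=> //.
- by move=> v _; case/andP: (cell v).
- move=> v _ i iv; have /andP[rv cv] := cell v; apply: has; first by lia.
  have h1 : (mu i <= mu (r v))%N by apply: mu_mono; lia.
  have h2 : (lam (r v) <= lam i)%N by apply: lam_anti; lia.
  by lia.
- have [||v [rv _]] := @cell_surj n (mu n).+1; last by exists v.
    by rewrite n_gt0 leqnn.
  by rewrite ltnSn mu_lam.
- move=> u w _ _ lt; have /andP[rw cw] := cell w.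
  rewrite /corner_graph /corner lt [(r w < r u)%N]ltnNge (ltnW lt) /= orbF.
  have [cuw|//] := ltnP (c u) (c w); rewrite /= orbC; congr (_ || _).
  apply/idP/has_cellP => [h|[x _ [rx cx]]]; last first.
    by have := cell x; rewrite rx cx; lia.
  have [x [rx cx]] : exists x, r x = r w /\ c x = c u by apply: cell_surj => //; lia.
  by exists x.
- by move=> u w _ _ e; rewrite /corner_graph /corner e ltnn.
- by move=> u w _; rewrite in_setT.
- move=> v j _ rv h; have /andP[_ cv] := cell v; rewrite rv in cv.
  have := lam_anti (i := 1) (k := n); have := n_le_lam => h1 h2.
  by apply: has; lia.
Qed.

Lemma card_row_from i a : (0 < i <= n)%N ->
  #|[set v | (r v == i) && (a <= c v)%N]| = (lam i - maxn (mu i) a.-1)%N.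
Proof.
move=> hi; set S := [set v | _].
rewrite cardE -(size_map c) -(size_iota (maxn (mu i) a.-1).+1 (lam i - maxn (mu i) a.-1)).
apply: perm_size; apply: uniq_perm; [|exact: iota_uniq|].
  rewrite map_inj_in_uniq ?enum_uniq // => u v.
  rewrite !mem_enum !inE => /andP[/eqP ru _] /andP[/eqP rv _] cuv.
  by apply: cell_inj; rewrite ?ru ?rv.
move=> j; rewrite mem_iota; apply/mapP/idP => [[v]|hj].
  by rewrite mem_enum inE => /andP[/eqP rv av] ->; have := cell v; rewrite rv; lia.
have [v [rv cv]] : exists v, r v = i /\ c v = j by apply: cell_surj => //; lia.
by exists v; rewrite // mem_enum inE rv cv eqxx /=; lia.
Qed.

Lemma card_rows : N = (\sum_(1 <= i < n.+1) (lam i - mu i))%N.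
Proof.
have h k : (k <= n)%N -> #|[set v | r v <= k]%N| = (\sum_(1 <= i < k.+1) (lam i - mu i))%N.
  elim: k => [_|k IH kn].
    rewrite big_geq // -[RHS](@cards0 'I_N); apply: eq_card => v; rewrite !inE.
    by have := cell v; lia.
  rewrite big_nat_recr //= -IH; last by lia.
  have -> : (lam k.+1 - mu k.+1 = #|[set v | (r v == k.+1) && (0 <= c v)%N]|)%N.
    by rewrite card_row_from ?maxn0 //; lia.
  rewrite -cardsUI [_ :&: _](_ : _ = set0) ?cards0 ?addn0; last first.
    by apply/setP => v; rewrite !inE; lia.
  by apply: eq_card => v; rewrite !inE; lia.
rewrite -h // -[LHS]card_ord; apply: eq_card => v; rewrite !inE.
by have := cell v; lia.
Qed.

(** The truncated difference is the maximum in the height formula: the top row starts after column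
    max(mu 1, n - 1). *)
Lemma ladder_codim :
  (N - (#|top_row r c n setT| + n.-1) =
     (n.-1 - mu 1%N) + \sum_(2 <= i < n.+1) (lam i - mu i - 1))%N.
Proof.
have -> : #|top_row r c n setT| = (lam 1%N - maxn (mu 1%N) n.-1)%N.
  by rewrite -card_row_from; [apply: eq_card => v; rewrite !inE|lia].
have := card_rows; rewrite big_ltn //.
have -> : (\sum_(2 <= i < n.+1) (lam i - mu i) =
           \sum_(2 <= i < n.+1) (lam i - mu i - 1) + n.-1)%N.
  have -> : n.-1 = (\sum_(2 <= i < n.+1) 1)%N by rewrite sum_nat_const_nat; lia.
  rewrite -big_split /=; apply: eq_big_nat => i hi.
  by have : (mu i < lam i)%N by [apply: mu_lt_lam; lia]; lia.
have h1 : (lam n <= lam 1%N)%N by apply: lam_anti; lia.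
have h2 : (mu 1%N < lam 1%N)%N by apply: mu_lt_lam; lia.
by have := n_le_lam; set s := (\sum_(2 <= i < n.+1) _)%N; lia.
Qed.

(** Summed over a monomial this is a linear functional of the exponents of its toric image, hence
    equal for monomials with the same image. *)
Definition weight (f : nat -> int) v : int := f (r v) + f (c v).

(** In the difference of the sums the cells before [v] cancel, [v] contributes a positive amount,
    and after [v] the cells of [m1] have weight 0 while those of [m2] are subtracted with
    nonpositive weight. *)
Lemma weight_gt m1 m2 v (f : nat -> int) :
  (m2 v < m1 v)%N -> (forall u, cell_gt u v -> m1 u = m2 u) ->
  0 < weight f v -> (forall u, cell_gt v u -> weight f u <= 0) ->
  (forall u, cell_gt v u -> (0 < m1 u)%N -> 0 <= weight f u) ->
  \sum_u (m1 u)%:Z * weight f u != \sum_u (m2 u)%:Z * weight f u.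
Proof.
move=> lt eqm fv fle fge; rewrite -subr_eq0 -sumrB (bigD1 v) //=.
apply: lt0r_neq0; apply: ltr_pwDl.
  by rewrite -mulrBl pmulr_rgt0 ?subr_gt0 ?ltz_nat.
apply: sumr_ge0 => u uv; have [guv|ngu] := boolP (cell_gt u v).
  by rewrite eqm // subrr.
have gvu : cell_gt v u.
  have : ~~ ((r u == r v) && (c u == c v)).
    by apply/negP => /andP[/eqP er /eqP ec]; rewrite (cell_inj er ec) eqxx in uv.
  by move: ngu; rewrite /cell_gt; lia.
rewrite subr_ge0; apply: (@le_trans _ _ 0).
  by rewrite mulr_ge0_le0 // fle.
case: (posnP (m1 u)) => [->|m1u]; first by rewrite mul0r.
by rewrite mulr_ge0 // fge.
Qed.

(* Assume [m1] contains no corner pair, and let [v = (i, j)] be the first variable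
   where [m1] exceeds [m2]. Weight +1 on i and -1 beyond j separates the two monomials,
   unless [m1] contains some (k, l) with i < k <= j <= mu k; then +1 on i and on
   {x in (i, j] : j <= mu x}, and -1 on the other indices, does. *)
Lemma corner_of_lex m1 m2 :
  (forall f : nat -> int,
     \sum_u (m1 u)%:Z * weight f u = \sum_u (m2 u)%:Z * weight f u) ->
  lex_gt cell_gt m1 m2 -> exists a b, [/\ corner a b, (0 < m1 a)%N & (0 < m1 b)%N].
Proof.
move=> eqw [v [lt eqm]]; apply: NNPP => no.
have std a b : (0 < m1 a)%N -> (0 < m1 b)%N -> corner a b = false.
  by move=> ma mb; apply/negP => ab; apply: no; exists a, b.
have mv : (0 < m1 v)%N by apply: leq_ltn_trans lt.
have after u : cell_gt v u -> (r u = r v /\ (c v < c u)%N) \/ (r v < r u)%N.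
  by rewrite /cell_gt => /orP[|/andP[/eqP -> ?]]; [right|left].
(* Rows below [v] that start at or left of its column: a cell of [m1] in such a row and beyond that
   column would form a corner with [v]. *)
pose B (x : nat) := [&& (r v < x)%N, (x <= n)%N & (mu x < c v)%N].
have vB u : (0 < m1 u)%N -> B (r u) -> (c u <= c v)%N.
  move=> mu_ /and3P[b1 b2 b3]; have := std v u mv mu_; rewrite /corner b1 b3 /=.
  by rewrite andbT ltnNge => /negbFE.
have rowD u : (0 < m1 u)%N -> (c v < r u)%N -> False.
  move=> mu_ h; have := std v u mv mu_; rewrite /corner h orbT andbT.
  by have := row_le_col u; have := row_le_col v; lia.
have [[u0 [mu0 hu0]]|noC] := classic (exists u0, (0 < m1 u0)%N /\
    [&& r v < r u0, r u0 <= c v & c v <= mu (r u0)])%N.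
  pose f (x : nat) : int := if B x || (c v < x)%N then -1 else 1.
  have /and3P[u01 u02 u03] := hu0; have /andP[ru0 cu0] := cell u0.
  have notB (x : nat) : (r u0 <= x)%N -> B x = false.
    move=> h; apply/negP => /and3P[x1 x2 x3].
    by have := mu_mono (i := r u0) (k := x); lia.
  have Bi : B (r v) = false by rewrite /B ltnn.
  have := row_le_col v => rcv.
  have fi : f (r v) = 1 by rewrite /f Bi ltnNge rcv.
  have fD (x : nat) : (c v < x)%N -> f x = -1 by rewrite /f => ->; rewrite orbT.
  have fle (x : nat) : f x <= 1 by rewrite /f; case: ifP.
  apply: (negP (weight_gt lt eqm (f := f) _ _ _)); last by rewrite eqw.
  - by rewrite /weight fi /f notB ?ltnn //; lia.
  - move=> u /after[[ru cu]|ru]; first by rewrite /weight ru fi fD.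
    rewrite /weight; have [Bu|nB] := boolP (B (r u)).
      by have := fle (c u); rewrite {2}/f Bu /=; lia.
    have [cu|cu] := ltnP (c v) (r u); first by have := fle (c u); rewrite (fD (r u)) //; lia.
    have h : (c v < c u)%N.
      by have := cell u; move: nB; rewrite /B ru /=; lia.
    by have := fle (r u); rewrite (fD (c u)) //; lia.
  - move=> u /after[[ru cu] _|ru mu_]; first by rewrite /weight ru fi fD.
    have [Bu|nB] := boolP (B (r u)).
      have cu := vB u mu_ Bu.
      have h : (r u0 <= c u)%N.
        have := std u u0 mu_ mu0; rewrite /corner.
        have : (r u < r u0)%N by rewrite ltnNge; apply/negP => /notB; rewrite Bu.
        by lia.
      by rewrite /weight /f Bu (notB (c u)) //= ltnNge cu.
    have [cu|cu] := ltnP (c v) (r u); first by case: (rowD u).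
    have h : (c v < c u)%N.
      by have := cell u; move: nB; rewrite /B ru /=; lia.
    by rewrite /weight (fD (c u)) // /f (negbTE nB) ltnNge cu.
pose f (x : nat) : int := if (c v < x)%N then -1 else if x == r v then 1 else 0.
have := row_le_col v => rcv.
have fi : f (r v) = 1 by rewrite /f ltnNge rcv eqxx.
have fD (x : nat) : (c v < x)%N -> f x = -1 by rewrite /f => ->.
have fle (x : nat) : (r v < x)%N -> f x <= 0.
  by move=> h; rewrite /f; case: ifP => //; case: eqP => // e; rewrite e ltnn in h.
apply: (negP (weight_gt lt eqm (f := f) _ _ _)); last by rewrite eqw.
- by rewrite /weight fi /f ltnn; case: ifP.
- move=> u /after[[ru cu]|ru]; first by rewrite /weight ru fi fD.
  by rewrite /weight; have := fle _ ru; have := fle _ (leq_trans ru (row_le_col u)); lia.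
move=> u /after[[ru cu] _|ru mu_]; first by rewrite /weight ru fi fD.
have [Bu|nB] := boolP (B (r u)).
  have cu := vB u mu_ Bu; have := row_le_col u => rcu.
  rewrite /weight /f !ltnNge (leq_trans rcu cu) cu /=.
  by case: ifP; case: ifP.
have [cu|cu] := ltnP (c v) (r u); first by case: (rowD u).
case: noC; exists u; split=> //.
by have := cell u; move: nB; rewrite /B ru cu /=; lia.
Qed.

(** * The toric map and leading monomials *)

Section Initial.
Variable M : nat.
Hypothesis row_bound : forall v, (r v <= M)%N.
Hypothesis col_bound : forall v, (c v <= M)%N.

Definition content m : 'X_{1..M.+1} :=
  (\sum_(v < N) (U_(inord (r v)) + U_(inord (c v))) *+ m v)%MM.

Definition toric : R -> {mpoly K[M.+1]} :=
  mmap (@mpolyC M.+1 K) (fun v => 'X_(inord (r v)) * 'X_(inord (c v))).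

HB.instance Definition _ := GRing.RMorphism.copy toric
  (mmap (@mpolyC M.+1 K) (fun v => 'X_(inord (r v)) * 'X_(inord (c v)))).

Lemma toricX v : toric 'X_v = 'X_(inord (r v)) * 'X_(inord (c v)).
Proof. by rewrite /toric mmapX mmap1U. Qed.

Lemma toricE p : toric p = \sum_(m <- msupp p) p@_m *: 'X_[content m].
Proof.
rewrite /toric /mmap; apply: eq_bigr => m _; rewrite mul_mpolyC; congr (_ *: _).
rewrite /mmap1 /content -mprodXE; apply: eq_bigr => v _.
by rewrite -mpolyXD mpolyXn.
Qed.

Lemma content_weight m (f : nat -> int) :
  \sum_u (m u)%:Z * weight f u = \sum_(x < M.+1) (content m x)%:Z * f x.
Proof.
under [RHS]eq_bigr => x _ do rewrite mnm_sumE -natz natr_sum mulr_suml.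
rewrite exchange_big; apply: eq_bigr => u _ /=.
have delta i : (i <= M)%N -> \sum_(x < M.+1) ((inord i == x :> 'I_M.+1)%:R : int) * f x = f i.
  move=> iM; rewrite (bigD1 (inord i)) //= eqxx mul1r inordK // big1 ?addr0 //.
  by move=> x xi; rewrite eq_sym (negbTE xi) mul0r.
rewrite /weight -(delta _ (row_bound u)) -(delta _ (col_bound u)) -big_split big_distrr /=.
apply: eq_bigr => x _; rewrite mulmnE mnmDE !mnm1E natrM natrD natz; ring.
Qed.

(** The image of the leading monomial must cancel against that of another, smaller monomial of [p],
    to which [corner_of_lex] applies. *)
Lemma toric_kernel_corner p m : toric p = 0 -> is_lead cell_gt p m ->
  exists a b, [/\ corner a b, (0 < m a)%N & (0 < m b)%N].
Proof.
move=> p0 [mp lead]; have := congr1 (mcoeff (content m)) p0.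
rewrite toricE raddf_sum mcoeff0 /= (bigD1_seq m) ?msupp_uniq //=.
rewrite mcoeffZ mcoeffX eqxx mulr1 => e.
have [m' [m'p m'm em]] : exists m', [/\ m' \in msupp p, m' != m & content m' = content m].
  apply: NNPP => no; move: mp; rewrite mcoeff_msupp.
  move: e; rewrite big_seq_cond big1 ?addr0 => [->|m' /andP[m'p m'm]]; first by rewrite eqxx.
  rewrite mcoeffZ mcoeffX; case: eqP => e; last by rewrite mulr0.
  by case: no; exists m'.
apply: (@corner_of_lex m m') (lead _ m'p m'm) => f.
by rewrite !content_weight em.
Qed.

Variable S : R -> Prop.
Hypothesis S_toric : forall p, S p -> toric p = 0.
Hypothesis S_corner : forall u w, corner u w -> exists x y,
  [/\ cell_gt u x, cell_gt u y & S ('X_u * 'X_w - 'X_x * 'X_y)].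

Lemma cell_gt_neq u x : cell_gt u x -> (x == u) = false.
Proof.
by move=> h; apply/eqP => e; move: h; rewrite e /cell_gt !ltnn andbF.
Qed.

Lemma cell_gt_asym u x : cell_gt u x -> cell_gt x u = false.
Proof. by rewrite /cell_gt; lia. Qed.

(** The cell [u] precedes the other three, so its exponent alone decides the comparison. *)
Lemma corner_lead u w x y : corner u w -> cell_gt u x -> cell_gt u y ->
  let p : R := 'X_u * 'X_w - 'X_x * 'X_y in
  p != 0 /\ is_lead cell_gt p (U_(u) + U_(w))%MM.
Proof.
move=> uw ux uy; have guw : cell_gt u w by rewrite /cell_gt; case/and3P: uw => ->.
have [[wu xu] yu] := (cell_gt_neq guw, cell_gt_neq ux, cell_gt_neq uy).
move=> p0; rewrite {}/p0 -!mpolyXD.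
set m := (U_(u) + U_(w))%MM; set m' := (U_(x) + U_(y))%MM; set p := _ - _.
have mm' : (m' == m) = false.
  apply/eqP => /(congr1 (fun m0 : 'X_{1..N} => m0 u)).
  by rewrite !mnmDE !mnm1E xu yu wu eqxx.
have mp : m \in msupp p.
  by rewrite mcoeff_msupp mcoeffB !mcoeffX eqxx mm' subr0 oner_eq0.
split; first by apply: contraTneq mp => ->; rewrite msupp0.
split=> // m0 m0p m0m; have -> : m0 = m'.
  move: (msuppB_le m0p); rewrite mem_cat !msuppX !inE (negbTE m0m) /=.
  by move/eqP.
exists u; split; first by rewrite !mnmDE !mnm1E xu yu wu eqxx.
move=> t tu; rewrite !mnmDE !mnm1E.
have ne z : cell_gt u z -> (z == t) = false.
  by move=> uz; apply/eqP => e; move: (cell_gt_asym uz); rewrite e tu.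
by rewrite (ne w) // (ne x) // (ne y) // (cell_gt_neq tu).
Qed.

Lemma init_ideal_corner :
  eqI (init_ideal cell_gt (ideal_gen S)) (edge_ideal corner_graph set0 setT).
Proof.
have iE := @is_ideal_edge K N corner_graph set0 setT.
move=> q; split; move: q.
  apply: ideal_gen_sub => // _ [p [m [Sp [_ [lead ->]]]]].
  have p0 : toric p = 0.
    move: p Sp {lead}; apply: ideal_gen_sub => //; split; first exact: rmorph0.
    split; first by move=> a b ha hb; rewrite rmorphD /= ha hb addr0.
    by move=> a b hb; rewrite rmorphM /= hb mulr0.
  have [a [b [ab ma mb]]] := toric_kernel_corner p0 lead.
  have le : (U_(a) + U_(b) <= m)%MM.
    apply/mnm_lepP => i; rewrite mnmDE !mnm1E.
    have ba : a != b by apply: contraTneq ab => ->; rewrite /corner ltnn.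
    case: eqP => [<-|_]; first by rewrite eq_sym (negbTE ba).
    by case: eqP => [<-|_].
  rewrite -(submK le) !mpolyXD; apply: is_idealMl => //.
  by apply: edge_idealXX; rewrite ?in_setT // /corner_graph ab.
apply: edge_ideal_sub; first exact: is_ideal_gen.
  by move=> w; rewrite in_set0.
have main a b : corner a b -> init_ideal cell_gt (ideal_gen S) ('X_a * 'X_b).
  move=> ab; have [x [y [ax ay Sp]]] := S_corner ab.
  have [p0 lead] := corner_lead ab ax ay.
  apply: mem_ideal_gen; exists ('X_a * 'X_b - 'X_x * 'X_y), (U_(a) + U_(b))%MM.
  by rewrite mpolyXD; split; [exact: mem_ideal_gen|].
move=> a b _ _ /orP[|ab]; first exact: main.
by rewrite mulrC; apply: main.
Qed.

Lemma init_ideal_ladder (I := init_ideal cell_gt (ideal_gen S)) :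
  (sqfree_monomial_ideal I /\
   ideal_height I ((n.-1 - mu 1%N) + \sum_(2 <= i < n.+1) (lam i - mu i - 1))%N /\
   vertex_decomposable (SR_complex I) /\ CM_quot I) /\
  obtained_by_bdl_from_var_ideal I.
Proof.
have eI : eqI I (edge_ideal corner_graph set0 setT) := init_ideal_corner.
have -> : I = edge_ideal corner_graph set0 setT.
  by apply: boolp.funext => q; apply: boolp.propext; apply: eI.
have sym := corner_graph_sym; have irr := corner_graph_irr.
have sg := ladder_vdec sym irr cell_inj corner_ladder.
rewrite setDv cards0 add0n in sg.
have dis : [disjoint (set0 : {set 'I_N}) & setT] by rewrite -setI_eq0 set0I.
split; last first.
  have [ch [k [ch0 link chk]]] := @edge_ideal_chain K N _ sym irr _ _ sg set0 dis.
  by exists ch, k; split=> //; split=> // q; rewrite chk.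
split; [|split; [|split]].
- exists (fun m => exists a b, corner_graph a b /\ m = (U_(a) + U_(b))%MM); split.
    move=> _ [a [b [ab ->]]] i; rewrite mnmDE !mnm1E.
    have ba : (b == a) = false by apply/eqP => e; rewrite e irr in ab.
    by have [<-|_] := eqVneq a i; [rewrite ba|case: (b == i)].
  move=> q; split; move: q.
    apply: edge_ideal_sub; first exact: is_ideal_gen.
      by move=> w; rewrite in_set0.
    move=> a b _ _ ab; apply: mem_ideal_gen; exists (U_(a) + U_(b))%MM.
    by rewrite mpolyXD; split=> //; exists a, b.
  apply: ideal_gen_sub; first exact: is_ideal_edge.
  move=> _ [_ [[a [b [ab ->]]] ->]]; rewrite mpolyXD.
  by apply: edge_idealXX; rewrite ?in_setT.
- rewrite -ladder_codim.
  have := @edge_ideal_dim K N _ sym irr _ _ set0 sg dis.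
  by rewrite set0U setCT cards0 add0n => /has_dim_height.
- rewrite (@SR_edge_ideal K N corner_graph irr _ (fun q => iff_refl _)).
  exact: sg_vertex_decomposable sg.
- exact: edge_ideal_CM sg dis.
Qed.

End Initial.
End LadderIdeal.

(** * Tableaux *)

Section Tableaux.
Variables (K : fieldType) (n : nat) (lam mu : nat -> nat).
Hypothesis n_gt0 : (1 <= n)%N.
Hypothesis lam_step : forall i, (1 <= i < n)%N -> (lam i.+1 <= lam i)%N.
Hypothesis mu_step : forall i, (1 <= i < n)%N -> (mu i <= mu i.+1)%N.
Hypothesis mu_lam : (mu n < lam n)%N.
Hypothesis mu_diag : forall i, (1 <= i <= n)%N -> (i.-1 <= mu i)%N.
Local Notation R := {mpoly K[NV n lam mu]}.
Local Notation T := (Tvar K n lam mu).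

Definition vrow (v : 'I_(NV n lam mu)) := (var_pos n lam mu v).1.
Definition vcol (v : 'I_(NV n lam mu)) := (var_pos n lam mu v).2.

Let lam_anti i k : (0 < i <= k)%N -> (k <= n)%N -> (lam k <= lam i)%N.
Proof.
apply: (steps_homo (R := fun a b => (b <= a)%N)) => //.
by move=> b a d ab bd; apply: leq_trans bd ab.
Qed.

Let mu_mono i k : (0 < i <= k)%N -> (k <= n)%N -> (mu i <= mu k)%N.
Proof. exact: (steps_homo (R := leq) leqnn leq_trans). Qed.

Let n_le_lam : (n <= lam n)%N.
Proof. by have := @mu_diag n; rewrite n_gt0 leqnn => /(_ isT); lia. Qed.

Let n_le_lam1 : (n <= lam 1%N)%N.
Proof. by apply: leq_trans n_le_lam _; apply: lam_anti. Qed.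

Lemma var_posP v : posT n lam mu (vrow v, vcol v).
Proof. exact: valP (enum_val v). Qed.

Lemma var_cell v : (0 < vrow v <= n)%N && (mu (vrow v) < vcol v <= lam (vrow v))%N.
Proof. exact: var_posP. Qed.

Lemma var_pos_inj u v : vrow u = vrow v -> vcol u = vcol v -> u = v.
Proof.
move=> er ec; apply: enum_val_inj; apply: val_inj.
rewrite [LHS]surjective_pairing [RHS]surjective_pairing.
by congr (_, _); apply: val_inj.
Qed.

Lemma var_of_pos i j : posT n lam mu (i, j) ->
  exists v, [/\ vrow v = i, vcol v = j & T (i, j) = 'X_v].
Proof.
move=> pij; have /andP[/= i_n j_l] := pij.
have li : (i < (lam 1%N).+1)%N by lia.
have lj : (j < (lam 1%N).+1)%N.
  by have : (lam i <= lam 1%N)%N by [apply: lam_anti; lia]; lia.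
pose x : 'I_(lam 1%N).+1 * 'I_(lam 1%N).+1 := (inord i, inord j).
have px : posT n lam mu (val x.1, val x.2) by rewrite /= !inordK.
exists (enum_rank (Sub x px : TPos n lam mu)); split.
- by rewrite /vrow /var_pos enum_rankK /= inordK.
- by rewrite /vcol /var_pos enum_rankK /= inordK.
by rewrite /Tvar insubT.
Qed.

Lemma Tvar_pos v : T (vrow v, vcol v) = 'X_v.
Proof.
by have [u [er ec ->]] := var_of_pos (var_posP v); rewrite (var_pos_inj er ec).
Qed.

Section Shift.
Variable s : nat.

Definition scol v := (vcol v + s)%N.

Lemma var_gt_shift : var_gt n lam mu = cell_gt vrow scol.
Proof.
apply: boolp.funext => u; apply: boolp.funext => v; rewrite /var_gt /cell_gt /scol ltn_add2r.
by rewrite /vrow /vcol; case: (var_pos n lam mu u); case: (var_pos n lam mu v).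
Qed.

Definition toric_entry i j : {mpoly K[(lam 1%N + s).+1]} := 'X_(inord i) * 'X_(inord (j + s)).

Lemma toric_var v :
  toric vrow scol (lam 1%N + s) 'X_v = toric_entry (vrow v) (vcol v).
Proof. by rewrite toricX. Qed.

Lemma init_ideal_shift (S : R -> Prop) :
  (forall p, S p -> toric vrow scol (lam 1%N + s) p = 0) ->
  (forall u w, corner vrow scol (fun i => mu i + s)%N u w -> exists x y,
    [/\ cell_gt vrow scol u x, cell_gt vrow scol u y & S ('X_u * 'X_w - 'X_x * 'X_y)]) ->
  (sqfree_monomial_ideal (init_ideal (var_gt n lam mu) (ideal_gen S)) /\
   ideal_height (init_ideal (var_gt n lam mu) (ideal_gen S))
     ((n.-1 - (mu 1%N + s)) + \sum_(2 <= i < n.+1) (lam i - mu i - 1))%N /\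
   vertex_decomposable (SR_complex (init_ideal (var_gt n lam mu) (ideal_gen S))) /\
   CM_quot (init_ideal (var_gt n lam mu) (ideal_gen S))) /\
  obtained_by_bdl_from_var_ideal (init_ideal (var_gt n lam mu) (ideal_gen S)).
Proof.
move=> hS hC; rewrite var_gt_shift.
have -> : (\sum_(2 <= i < n.+1) (lam i - mu i - 1) =
    \sum_(2 <= i < n.+1) ((lam i + s) - (mu i + s) - 1))%N.
  by apply: eq_bigr => i _; rewrite subnDr.
apply: (@init_ideal_ladder K _ vrow scol n (fun i => lam i + s)%N (fun i => mu i + s)%N
  n_gt0 _ _ _ _ _ _ _ (lam 1%N + s)) => //.
- by move=> v; have := var_cell v; rewrite /scol; lia.
- move=> i j hi hj.
  have pij : posT n lam mu (i, j - s)%N by apply/andP; split=> //=; lia.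
  by have [v [rv cv _]] := var_of_pos pij; exists v; rewrite /scol rv cv; split=> //; lia.
- by move=> u v er /addIn; apply: var_pos_inj.
- by move=> i k ik kn; rewrite leq_add2r; apply: lam_anti.
- by move=> i k ik kn; rewrite leq_add2r; apply: mu_mono.
- by rewrite ltn_add2r.
- by move=> i hi; apply: leq_trans (mu_diag hi) (leq_addr _ _).
- by move=> v; have := var_cell v; lia.
- move=> v; have /andP[rv cv] := var_cell v; rewrite /scol leq_add2r.
  by have : (lam (vrow v) <= lam 1%N)%N by [apply: lam_anti; lia]; lia.
Qed.

End Shift.

Lemma arrT_var i j x : arrT K n lam mu i j = Some x ->
  exists v, [/\ vrow v = i, vcol v = j & x = 'X_v].
Proof.
by rewrite /arrT; case: ifP => // /var_of_pos[v [rv cv ->]] [<-]; exists v.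
Qed.

Lemma arrT_at v : arrT K n lam mu (vrow v) (vcol v) = Some 'X_v.
Proof. by rewrite /arrT var_posP Tvar_pos. Qed.

Lemma arrS_at v : arrS K n lam mu (vrow v) (vcol v) = Some 'X_v.
Proof. by rewrite /arrS var_posP Tvar_pos. Qed.

(** A cell never lies below the diagonal, by [mu_diag]; so the mirror position is itself a cell only
    on the diagonal, where both readings agree. *)
Lemma arrS_at_sym v : arrS K n lam mu (vcol v) (vrow v) = Some 'X_v.
Proof.
rewrite /arrS; case: ifP => [h|_]; last by rewrite var_posP Tvar_pos.
have /andP[rv cv] := var_cell v; have /andP[/= h1 h2] := h.
have d1 := mu_diag rv; have d2 := mu_diag h1.
have e : vcol v = vrow v by lia.
by have := Tvar_pos v; rewrite e => ->.
Qed.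

(* The shift by [n] makes every column index exceed every row index, so that the toric
   map of T becomes that of a symmetric tableau and the corner condition [c u < r w] is
   void. *)
Lemma toric_minorT p : minor2 (arrT K n lam mu) p -> toric vrow (scol n) (lam 1%N + n) p = 0.
Proof.
move=> [i [j [k [l [x [y [z [w [_ [_ [hx [hy [hz [hw ->]]]]]]]]]]]]]].
move: hx hy hz hw => /arrT_var[a [ra ca ->]] /arrT_var[b [rb cb ->]].
move=> /arrT_var[d [rd cd ->]] /arrT_var[f [rf cf ->]].
rewrite rmorphB !rmorphM /= !toric_var /toric_entry.
by rewrite ra ca rb cb rd cd rf cf; ring.
Qed.

Lemma rectangle u w : (vrow u < vrow w)%N -> (vcol u < vcol w)%N -> (mu (vrow w) < vcol u)%N ->
  exists x y, [/\ vrow x = vrow u, vcol x = vcol w, vrow y = vrow w & vcol y = vcol u].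
Proof.
move=> ruw cuw muw; have /andP[ru cu] := var_cell u; have /andP[rw cw] := var_cell w.
have l1 : (lam (vrow w) <= lam (vrow u))%N by apply: lam_anti; lia.
have p1 : posT n lam mu (vrow u, vcol w) by apply/andP; split=> //=; lia.
have p2 : posT n lam mu (vrow w, vcol u) by apply/andP; split=> //=; lia.
have [x [rx cx _]] := var_of_pos p1; have [y [ry cy _]] := var_of_pos p2.
by exists x, y.
Qed.

Lemma corner_minorT u w : corner vrow (scol n) (fun i => mu i + n)%N u w -> exists x y,
  [/\ cell_gt vrow (scol n) u x, cell_gt vrow (scol n) u y
    & minor2 (arrT K n lam mu) ('X_u * 'X_w - 'X_x * 'X_y)].
Proof.
rewrite /corner /scol !ltn_add2r => /and3P[ruw cuw h].
have /andP[rw _] := var_cell w.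
have muw : (mu (vrow w) < vcol u)%N by lia.
have [x [y [rx cx ry cy]]] := rectangle ruw cuw muw.
exists x, y; rewrite /cell_gt /scol rx cx ry ruw eqxx ltn_add2r cuw orbT; split=> //.
exists (vrow u), (vcol u), (vrow w), (vcol w), 'X_u, 'X_w, 'X_x, 'X_y.
have := arrT_at x; have := arrT_at y; rewrite rx cx ry cy => -> ->.
by rewrite !arrT_at.
Qed.

Lemma toric_minorS p : minor2 (arrS K n lam mu) p -> toric vrow (scol 0) (lam 1%N + 0) p = 0.
Proof.
have entry i j x : arrS K n lam mu i j = Some x ->
    toric vrow (scol 0) (lam 1%N + 0) x = 'X_(inord i) * 'X_(inord j).
  rewrite /arrS; case: ifP => [/var_of_pos[v [rv cv ->]] [<-]|_].
    by rewrite toric_var /toric_entry rv cv (addn0 j).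
  case: ifP => // /var_of_pos[v [rv cv ->]] [<-].
  by rewrite toric_var /toric_entry rv cv (addn0 i) mulrC.
move=> [i [j [k [l [x [y [z [w [_ [_ [hx [hy [hz [hw ->]]]]]]]]]]]]]].
rewrite rmorphB !rmorphM /= (entry _ _ _ hx) (entry _ _ _ hy) (entry _ _ _ hz).
by rewrite (entry _ _ _ hw); ring.
Qed.

Lemma corner_minorS u w : corner vrow (scol 0) (fun i => mu i + 0)%N u w -> exists x y,
  [/\ cell_gt vrow (scol 0) u x, cell_gt vrow (scol 0) u y
    & minor2 (arrS K n lam mu) ('X_u * 'X_w - 'X_x * 'X_y)].
Proof.
rewrite /corner /scol !addn0 => /and3P[ruw cuw /orP[muw|crw]].
  have [x [y [rx cx ry cy]]] := rectangle ruw cuw muw.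
  exists x, y; rewrite /cell_gt /scol !addn0 rx cx ry ruw eqxx cuw orbT; split=> //.
  exists (vrow u), (vcol u), (vrow w), (vcol w), 'X_u, 'X_w, 'X_x, 'X_y.
  have := arrS_at x; have := arrS_at y; rewrite rx cx ry cy => -> ->.
  by rewrite !arrS_at.
have /andP[ru cu] := var_cell u; have /andP[rw cw] := var_cell w.
have d1 := mu_diag ru; have d2 := mu_diag rw.
have l1 : (lam (vrow w) <= lam (vrow u))%N by apply: lam_anti; lia.
have l2 : (lam (vrow w) <= lam (vcol u))%N by apply: lam_anti; lia.
have m2 : (mu (vcol u) <= mu (vrow w))%N by apply: mu_mono; lia.
(* Since [vcol u < vrow w <= n], row [vcol u] exists and lies above row [vrow w], hence contains
   column [vcol w]; its cell there is the mirror of the remaining corner of the minor. *)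
have p1 : posT n lam mu (vrow u, vrow w) by apply/andP; split=> //=; lia.
have p2 : posT n lam mu (vcol u, vcol w) by apply/andP; split=> //=; lia.
have [x [rx cx _]] := var_of_pos p1; have [y [ry cy _]] := var_of_pos p2.
exists x, y; rewrite /cell_gt /scol !addn0 rx cx ry cy eqxx; split; [lia|lia|].
exists (vrow u), (vcol u), (vcol w), (vrow w), 'X_u, 'X_w, 'X_x, 'X_y.
have := arrS_at x; have := arrS_at_sym y; rewrite rx cx ry cy => -> ->.
by rewrite arrS_at arrS_at_sym; do !split=> //; lia.
Qed.

End Tableaux.

Unset Implicit Arguments.

Theorem theorem3p3 (K : fieldType) (n : nat) (lam mu : nat -> nat) :
  (1 <= n)%N ->
  (forall i, (1 <= i <= n)%N -> (0 < lam i)%N) ->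
  (forall i, (1 <= i < n)%N -> (lam i.+1 <= lam i)%N) ->
  (forall i, (1 <= i < n)%N -> (mu i <= mu i.+1)%N) ->
  (mu n < lam n)%N ->
  (forall i, (1 <= i <= n)%N -> (i.-1 <= mu i)%N) ->
  (* (a) *)
  (sqfree_monomial_ideal (inT K n lam mu) /\
   ideal_height (inT K n lam mu) (\sum_(2 <= i < n.+1) (lam i - mu i - 1))%N /\
   vertex_decomposable (SR_complex (inT K n lam mu)) /\
   CM_quot (inT K n lam mu)) /\
  (* (b) *)
  (sqfree_monomial_ideal (inS K n lam mu) /\
   ideal_height (inS K n lam mu)
     ((n.-1 - mu 1%N) + \sum_(2 <= i < n.+1) (lam i - mu i - 1))%N /\
   vertex_decomposable (SR_complex (inS K n lam mu)) /\
   CM_quot (inS K n lam mu)) /\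
  (* moreover *)
  ((exists p, inT K n lam mu p /\ p != 0) ->
     obtained_by_bdl_from_var_ideal (inT K n lam mu)) /\
  ((exists p, inS K n lam mu p /\ p != 0) ->
     obtained_by_bdl_from_var_ideal (inS K n lam mu)).
Proof.
move=> n0 _ hlam hmu hml hd.
have [hT bT] := init_ideal_shift n0 hlam hmu hml hd
  (@toric_minorT K n lam mu n0 hlam hml hd)
  (@corner_minorT K n lam mu n0 hlam hml hd).
have [hS bS] := init_ideal_shift n0 hlam hmu hml hd
  (@toric_minorS K n lam mu n0 hlam hml hd)
  (@corner_minorS K n lam mu n0 hlam hmu hml hd).
(* The shift by [n] annihilates the extra term of the height, which leaves the height in (a). *)
have e : (n.-1 - (mu 1%N + n) = 0)%N by lia.
by rewrite e add0n in hT; rewrite addn0 in hS; split; [|split; [|split]].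
Qed.
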